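(* Let $(M_1\times_fM_2,F)$ be a twisted product Finsler manifold. Then the coefficients of the mean Berwald curvature are as follows: $$\mathbf E_{\alpha\beta}=E_{\alpha\beta}+fg_{\alpha\beta}I^hf_h+\tfrac12f^{-1}I^\nu_{;\alpha;\beta}f_\nu F_2^2+f^{-1}f_\nu\big(C^{\gamma\nu}_{\alpha;\beta}v_\gamma+I^\nu_{;\alpha}v_\beta+I^\nu_{;\beta}v_\alpha+C^\nu_{\alpha\beta}+I^\nu g_{\alpha\beta}\big),$$ $$\mathbf E_{ij}=E_{ij}+\tfrac12fI^h_{;j;i}f_hF_2^2,\qquad \mathbf E_{i\beta}=fI^h_{;i}f_hv_\beta,$$ where $E_{ij}$ and $E_{\alpha\beta}$ are the coefficients of the mean Berwald curvature of $(M_1,F_1)$ and $(M_2,F_2)$, respectively.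
   Context: Let $(M_1,F_1)$, $(M_2,F_2)$ be Finsler manifolds (metrics smooth on the slit tangent bundle, positively 1-homogeneous on fibres, with positive definite fundamental tensor) and $f:M_1\times M_2\to\mathbb{R}^+$ smooth. The twisted product $M_1\times_f M_2$ is $M=M_1\times M_2$ with $F=\sqrt{F_1^2(x,y)+f^2(x,u)F_2^2(u,v)}$, considered where $y\ne0$, $v\ne 0$. Local coordinates are $\mathbf{x}^a=(x^i,u^\alpha)$ with fibre coordinates $\mathbf{y}^a=(y^i,v^\alpha)$; Latin indices refer to $M_1$, Greek to $M_2$. For a Finsler metric $F$ with $g_{ij}=\frac12(F^2)_{y^iy^j}$, the spray coefficients are $G^i=\frac14g^{il}\big(\frac{\partial^2F^2}{\partial x^k\partial y^l}y^k-\frac{\partial F^2}{\partial x^l}\big)$, Berwald curvature $B^i_{\ jkl}=\frac{\partial^3G^i}{\partial y^j\partial y^k\partial y^l}$, and mean Berwald curvature $E_{jk}=\frac12B^m_{\ jkm}$. $\mathbf E_{ab}$ is the mean Berwald curvature of the twisted product metric $F$ in the coordinates $(\mathbf x^a,\mathbf y^a)$. $g_{ij}$, $g_{\alpha\beta}$ are the fundamental tensors of $F_1,F_2$; $v_\alpha=g_{\alpha\beta}v^\beta$; $C_{ijk}=\frac12\frac{\partial g_{ij}}{\partial y^k}$, $C_{\alpha\beta\gamma}=\frac12\frac{\partial g_{\alpha\beta}}{\partial v^\gamma}$, indices raised by $g^{ij}$, $g^{\alpha\beta}$; $I^h=C^{kh}_k$, $I^\nu=C^{\gamma\nu}_\gamma$;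 $;i$ denotes $\partial/\partial y^i$ and $;\beta$ denotes $\partial/\partial v^\beta$; $f_h=\frac{\partial f}{\partial x^h}$, $f_\nu=\frac{\partial f}{\partial u^\nu}$. *)

(* Defs.v *)
From HB Require Import structures.
From mathcomp Require Export all_boot all_order all_algebra.
From mathcomp Require Export all_classical all_reals all_analysis.

Set Implicit Arguments.
Unset Strict Implicit.
Unset Printing Implicit Defensive.

Import Order.TTheory GRing.Theory Num.Theory.
Export numFieldNormedType.Exports.

Local Open Scope classical_set_scope.
Local Open Scope ring_scope.

(** * Smooth maps *)

(* Used only for open subsets A of finite-dimensional spaces, where it is
   equivalent to say that the derivative of f is C^k and that x |-> 'D_v f x is
   C^k for every v. *)
Fixpoint Ck_on (R : realType) (V W : normedModType R) (k : nat) (A : set V)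
    (f : V -> W) : Prop :=
  if k is k'.+1 then
    (forall x, A x -> differentiable f x) /\
    (forall v, Ck_on k' A (fun x => 'D_v f x))
  else forall x, A x -> {for x, continuous f}.

Definition smooth_on (R : realType) (V W : normedModType R) (A : set V)
    (f : V -> W) : Prop := forall k, Ck_on k A f.

(** * Smooth manifolds *)

(* A smooth n-manifold given by a (not necessarily maximal) smooth atlas:
   [chart a] maps [dom a] homeomorphically onto the open subset [cdom a] of R^n,
   with inverse [param a]. The values of [chart a] outside [dom a] and of
   [param a] outside [cdom a] are irrelevant. *)
Record manifold (R : realType) (n : nat) := Manifold {
  points :> topologicalType ;
  atlas : Type ;
  dom : atlas -> set points ;
  cdom : atlas -> set 'rV[R]_n ;
  chart : atlas -> points -> 'rV[R]_n ;
  param : atlas -> 'rV[R]_n -> points ;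
  points_hausdorff : hausdorff_space points ;
  points_second_countable : @second_countable points ;
  dom_cover : forall p, exists a, dom a p ;
  dom_open : forall a, open (dom a) ;
  cdom_open : forall a, open (cdom a) ;
  chart_cdom : forall a p, dom a p -> cdom a (chart a p) ;
  param_dom : forall a x, cdom a x -> dom a (param a x) ;
  chartK : forall a p, dom a p -> param a (chart a p) = p ;
  paramK : forall a x, cdom a x -> chart a (param a x) = x ;
  chart_continuous : forall a p, dom a p -> {for p, continuous (chart a)} ;
  param_continuous : forall a x, cdom a x -> {for x, continuous (param a)} ;
  transition_smooth : forall a b,
    smooth_on (cdom a `&` [set x | dom b (param a x)])
      (fun x => chart b (param a x))
}.

(* f o (param a x param b): the expression of f in the product chart (a, b) *)
Definition local_expr (R : realType) (n1 n2 : nat) (M1 : manifold R n1)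
    (M2 : manifold R n2) (f : M1 * M2 -> R) (a : atlas M1) (b : atlas M2)
    (q : 'rV[R]_n1 * 'rV[R]_n2) : R :=
  f (param a q.1, param b q.2).

Definition smooth_prod (R : realType) (n1 n2 : nat) (M1 : manifold R n1)
    (M2 : manifold R n2) (f : M1 * M2 -> R) : Prop :=
  forall a b, smooth_on (cdom a `*` cdom b) (local_expr f a b).

(** * Partial derivatives *)

(* For a function of (x, y), [pd1 i] is d/dx^i and [pd2 i] is d/dy^i. *)
Definition pd1 (R : realType) (m n : nat) (i : 'I_m)
    (H : 'rV[R]_m * 'rV[R]_n -> R) (q : 'rV[R]_m * 'rV[R]_n) : R :=
  'D_(delta_mx ord0 i, 0) H q.

Definition pd2 (R : realType) (m n : nat) (i : 'I_n)
    (H : 'rV[R]_m * 'rV[R]_n -> R) (q : 'rV[R]_m * 'rV[R]_n) : R :=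
  'D_(0, delta_mx ord0 i) H q.

(** * Tensors of a Finsler metric in local coordinates *)

Section LocalTensors.
Variables (R : realType) (n : nat).
Notation TR := ('rV[R]_n * 'rV[R]_n)%type.
Implicit Types (F : TR -> R) (q : TR).

Definition sqF F q : R := F q ^+ 2.

(* g_ij *)
Definition fund F (i j : 'I_n) q : R := 2^-1 * pd2 j (pd2 i (sqF F)) q.

Definition fund_mx F q : 'M[R]_n := \matrix_(i, j) fund F i j q.

(* g^ij *)
Definition fund_inv F (i j : 'I_n) q : R := invmx (fund_mx F q) i j.

(* G^i *)
Definition spray F (i : 'I_n) q : R :=
  4^-1 * \sum_l fund_inv F i l q *
           (\sum_k pd1 k (pd2 l (sqF F)) q * q.2 ord0 k - pd1 l (sqF F) q).

(* B^i_jkl *)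
Definition berwald F (i j k l : 'I_n) q : R :=
  pd2 j (pd2 k (pd2 l (spray F i))) q.

(* E_jk *)
Definition mean_berwald F (j k : 'I_n) q : R :=
  2^-1 * \sum_m berwald F m j k m q.

(* y_i *)
Definition low_y F (i : 'I_n) q : R := \sum_j fund F i j q * q.2 ord0 j.

(* C_ijk *)
Definition cartan F (i j k : 'I_n) q : R := 2^-1 * pd2 k (fund F i j) q.

(* C^i_jk *)
Definition cartan_u F (i j k : 'I_n) q : R :=
  \sum_s fund_inv F i s q * cartan F s j k q.

(* C^ij_k *)
Definition cartan_uu F (i j k : 'I_n) q : R :=
  \sum_s \sum_t fund_inv F i s q * fund_inv F j t q * cartan F s t k q.

(* I^h *)
Definition mean_cartan F (h : 'I_n) q : R := \sum_k cartan_uu F k h k q.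

End LocalTensors.

(** * Finsler manifolds *)

(* The tangent bundle is glued from the sets cdom a x R^n by the differentials
   of the transition maps, so a function on it is a family [metric a] of local
   expressions satisfying [metric_glue]. *)
Record finsler_manifold (R : realType) (n : nat) := FinslerManifold {
  fmanifold :> manifold R n ;
  metric : atlas fmanifold -> 'rV[R]_n * 'rV[R]_n -> R ;
  metric_glue : forall a b x y, cdom a x -> dom b (param a x) ->
    metric b (chart b (param a x),
              'd (fun z => chart b (param a z)) x y) = metric a (x, y) ;
  metric_ge0 : forall a x y, cdom a x -> 0 <= metric a (x, y) ;
  metric_smooth : forall a,
    smooth_on (cdom a `*` [set y | y != 0]) (metric a) ;
  metric_homogeneous : forall a x y (t : R), cdom a x -> 0 < t ->
    metric a (x, t *: y) = t * metric a (x, y) ;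
  metric_posdef : forall a x y (w : 'rV[R]_n), cdom a x -> y != 0 -> w != 0 ->
    0 < \sum_i \sum_j fund (metric a) i j (x, y) * w ord0 i * w ord0 j
}.

(** * Twisted products *)

(* Coordinates on T(M_1 x M_2) are ((x, u), (y, v)), with (x, u) = row_mx x u and
   (y, v) = row_mx y v; the index i of M_1 becomes lshift n2 i and the index
   alpha of M_2 becomes rshift n1 alpha. *)
Definition twisted_metric (R : realType) (n1 n2 : nat)
    (F1 : 'rV[R]_n1 * 'rV[R]_n1 -> R) (F2 : 'rV[R]_n2 * 'rV[R]_n2 -> R)
    (f : 'rV[R]_n1 * 'rV[R]_n2 -> R)
    (q : 'rV[R]_(n1 + n2) * 'rV[R]_(n1 + n2)) : R :=
  let x := lsubmx q.1 in let u := rsubmx q.1 in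
  let y := lsubmx q.2 in let v := rsubmx q.2 in
  Num.sqrt (F1 (x, y) ^+ 2 + f (x, u) ^+ 2 * F2 (u, v) ^+ 2).

(* The expression of the twisted product metric of M1 x_f M2 in the product
   chart (a, b). *)
Definition twisted_product (R : realType) (n1 n2 : nat)
    (M1 : finsler_manifold R n1) (M2 : finsler_manifold R n2)
    (f : M1 * M2 -> R) (a : atlas M1) (b : atlas M2) :
    'rV[R]_(n1 + n2) * 'rV[R]_(n1 + n2) -> R :=
  twisted_metric (metric a) (metric b) (local_expr f a b).

(* Main.v *)
(** Write L = F^2.  For the twisted product L = L1 + f^2 L2, so the fundamental
    tensor is block diagonal and the spray coefficients are
      G^i     = G1^i - 1/2 f g^il f_l L2,
      G^alpha = G2^alpha + f^-1 (f_k y^k + f_gamma v^gamma) v^alpha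
                - 1/2 f^-1 g^(alpha beta) f_beta L2.
    Since d g^il / d y^i = - 2 I^l and g^(alpha beta) L2_(;beta) = 2 v^alpha, their
    fibre divergence is
      div G1 + div G2 + f f_h I^h L2 + f^-1 f_nu I^nu L2 + (linear in y and v),
    and E_ab is half its fibre Hessian.  The two remaining terms of the formula for
    E_(alpha beta) cancel: differentiating C^(gamma nu)_alpha v_gamma = 0 in
    v^beta gives C^(gamma nu)_(alpha ; beta) v_gamma = - C^nu_(alpha beta). *)

From HB Require Import structures.
From mathcomp Require Import ring.
Require Import Defs.

Set Implicit Arguments.
Unset Strict Implicit.
Unset Printing Implicit Defensive.

Import Order.TTheory GRing.Theory Num.Theory.

Local Open Scope classical_set_scope.
Local Open Scope ring_scope.

(** * Smooth functions *)

(** The index contracted in [mean_berwald] is the one differentiated first in [berwald], so E_ab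
    comes from the scalar div G alone and no other part of the Berwald tensor is ever computed. Each
    term of that scalar is a product of a function of (x,u), one of (x,y) and one of (u,v). A fibre
    derivative acts on just one of the last two factors, so the three blocks of E_ab differ only in
    which factors get differentiated. The geometric identities are available only on the slit
    region, while derivatives are limits of functions defined everywhere. An identity survives
    differentiation because the region is open; hence the smoothness hypotheses on open sets and the
    repeated passage through [pd2_eq_on]. Symmetry of second derivatives is derived from the
    inductive notion of smoothness by a mean value argument. *)

Section LocalCongruence.
Variables (R : realType) (V W : normedModType R).
Implicit Types (f g : V -> W) (A : set V).

Lemma near0_differentiable f x : (\near x, f x = 0) -> differentiable f x.
Proof.
move=> f0.
have fx0 : f x = 0 by exact: nbhs_singleton f0.
have cx : (fun h : V => h + x) @ (0 : V) --> x.
  by rewrite -[X in _ --> X]add0r; apply: cvgD; [exact: cvg_id|exact: cvg_cst].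
have cz : continuous (\0 : {linear V -> W}) by move=> y; exact: cvg_cst.
(* The zero map is the candidate differential: near 0 the remainder vanishes identically, so it is
   trivially negligible. *)
have e : f \o shift x = cst (f x) + (\0 : {linear V -> W}) +o_ 0 id.
  apply/eqaddoP => e e0; near=> h => /=.
  rewrite !fctE fx0 /= add0r subr0.
  suff -> : f (h + x) = 0 by rewrite normr0 mulr_ge0// ltW.
  by near: h; exact: cx f0.
apply/diff_locallyP; rewrite (diff_unique cz e); split => //.
Unshelve. all: by end_near. Qed.

Lemma near_eq_differentiable f g x : (\near x, f x = g x) ->
  differentiable f x -> differentiable g x.
Proof.
move=> fg df.
have -> : g = f + (g - f) by rewrite addrC subrK.
apply: differentiableD => //; apply: near0_differentiable.
by near=> y; rewrite !fctE (near fg y) ?subrr//; near: y.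
Unshelve. all: by end_near. Qed.

Lemma derive_eq_on A f g v : open A -> {in A, f =1 g} ->
  {in A, 'D_v f =1 'D_v g}.
Proof.
move=> oA fg x; rewrite inE => Ax; apply: near_eq_derive.
by near=> y; apply: fg; rewrite inE; near: y; exact: open_nbhs_nbhs.
Unshelve. all: by end_near. Qed.

(** On an open set, equality on A is equality of germs at each point of A, so it passes to all
    directional derivatives and the induction closes. *)
Lemma Ck_on_eq k A f g : open A -> {in A, f =1 g} ->
  Ck_on k A f -> Ck_on k A g.
Proof.
elim: k f g => [|k IH] f g oA fg /=.
  move=> cf x Ax; have fgx : \near x, f x = g x.
    by near=> y; apply: fg; rewrite inE; near: y; exact: open_nbhs_nbhs.
  rewrite /prop_for /continuous_at -(fg x) ?inE//.
  by apply: cvg_trans (cf _ Ax); exact: near_eq_cvg.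
move=> [df Df]; split=> [x Ax|v].
  apply: near_eq_differentiable (df x Ax).
  by near=> y; apply: fg; rewrite inE; near: y; exact: open_nbhs_nbhs.
exact: IH (derive_eq_on _ oA fg) (Df v).
Unshelve. all: by end_near. Qed.

Lemma Ck_on_pred k A f : Ck_on k.+1 A f -> Ck_on k A f.
Proof.
elim: k f => [|k IH] f [df Df] /=.
  by move=> x Ax; exact: differentiable_continuous (df x Ax).
by split=> // v; apply: IH; exact: Df.
Qed.

Lemma Ck_on_cst k A (c : W) : Ck_on k A (fun=> c).
Proof.
elim: k c => [|k IH] c /=; first by move=> x _; exact: cvg_cst.
split=> [x _|v]; first exact: differentiable_cst.
have -> : (fun x => 'D_v (fun=> c) x) = ((fun=> 0) : V -> W).
  by apply/funext => x; exact: derive_cst.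
exact: IH.
Qed.

Lemma Ck_onD k A f g : open A -> Ck_on k A f -> Ck_on k A g ->
  Ck_on k A (fun x => f x + g x).
Proof.
move=> oA; elim: k f g => [|k IH] f g /=.
  by move=> cf cg x Ax; apply: cvgD; [exact: cf|exact: cg].
move=> [df Df] [dg Dg]; split=> [x Ax|v].
  by apply: differentiableD; [exact: df|exact: dg].
apply: (@Ck_on_eq k A (fun x => 'D_v f x + 'D_v g x) _ oA); last exact: IH.
move=> x; rewrite inE => Ax; rewrite deriveD//; apply: diff_derivable;
  [exact: df|exact: dg].
Qed.

Lemma Ck_on_subset k A (B : set V) f : A `<=` B -> Ck_on k B f -> Ck_on k A f.
Proof.
move=> AB; elim: k f => [|k IH] f /=; first by move=> cf x /AB; exact: cf.
by move=> [df Df]; split=> [x /AB|v]; [exact: df|exact/IH/Df].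
Qed.

End LocalCongruence.

(** * Pull-back along linear maps *)

Section PullBack.
Variables (R : realType) (U V W : normedModType R).

(* No differentiability is needed: the two difference quotients coincide. *)
Lemma derive_comp_linear (p : {linear U -> V}) (f : V -> W) w x :
  'D_w (fun x => f (p x)) x = 'D_(p w) f (p x).
Proof.
rewrite /derive.
rewrite (_ : (fun h => _) = (fun h : R => h^-1 *: ((f \o shift (p x)) (h *: p w) - f (p x))))//.
by apply/funext => h /=; rewrite linearP.
Qed.

(** A directional derivative of a pull-back is again a pull-back by the same p, in direction p v, so
    the induction hypothesis applies to it. *)
Lemma Ck_on_comp_linear (p : {linear U -> V}) k (A : set V) (f : V -> W) :
  continuous p -> Ck_on k A f -> Ck_on k (p @^-1` A) (fun x => f (p x)).
Proof.
move=> cp; elim: k f => [|k IH] f /=.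
  by move=> cf x Ax; apply: continuous_comp; [exact: cp|exact: cf].
move=> [df Df]; split=> [x Ax|v].
  apply: (@differentiable_comp _ _ _ _ p f); last exact: df.
  exact: linear_differentiable.
rewrite (_ : (fun x => 'D_v _ x) = fun x => 'D_(p v) f (p x)).
  exact: (IH ('D_(p v) f) (Df (p v))).
by apply/funext => x; exact: derive_comp_linear.
Qed.

End PullBack.

(** * Algebra of smooth real-valued functions *)

Section RealValued.
Variables (R : realType) (V : normedModType R) (A : set V).
Hypothesis oA : open A.
Implicit Types f g : V -> R.

Lemma smooth_on_derivable f x v : smooth_on A f -> A x -> derivable f x v.
Proof. by move=> /(_ 1%N)[df _] Ax; exact/diff_derivable/df. Qed.

Lemma smooth_on_derive f v : smooth_on A f -> smooth_on A ('D_v f).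
Proof. by move=> sf k; have [_] := sf k.+1; exact. Qed.

Lemma smooth_on_eq f g : {in A, f =1 g} -> smooth_on A f -> smooth_on A g.
Proof. by move=> fg sf k; exact: Ck_on_eq (sf k). Qed.

Lemma smooth_on_cst (c : R) : smooth_on A (fun=> c).
Proof. by move=> k; exact: Ck_on_cst. Qed.

Lemma smooth_onD f g : smooth_on A f -> smooth_on A g ->
  smooth_on A (fun x => f x + g x).
Proof. by move=> sf sg k; exact: Ck_onD. Qed.

(** The product rule leaves one factor undifferentiated, which is why [Ck_on_pred] is needed to
    lower its order. *)
Lemma Ck_onM k f g : Ck_on k A f -> Ck_on k A g ->
  Ck_on k A (fun x => f x * g x).
Proof.
elim: k f g => [|k IH] f g.
  by move=> cf cg x Ax; apply: cvgM; [exact: cf|exact: cg].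
move=> cf cg; have [[df Df] [dg Dg]] := (cf, cg); split=> [x Ax|v].
  by apply: differentiableM; [exact: df|exact: dg].
apply: (@Ck_on_eq _ _ _ k A (fun x => f x * 'D_v g x + g x * 'D_v f x) _ oA).
  move=> x; rewrite inE => Ax; rewrite deriveM; [by []|exact/diff_derivable/df|exact/diff_derivable/dg].
apply: Ck_onD => //; apply: IH.
- exact: Ck_on_pred cf.
- exact: Dg.
- exact: Ck_on_pred cg.
- exact: Df.
Qed.

Lemma smooth_onM f g : smooth_on A f -> smooth_on A g ->
  smooth_on A (fun x => f x * g x).
Proof. by move=> sf sg k; exact: Ck_onM. Qed.

Lemma smooth_onN f : smooth_on A f -> smooth_on A (fun x => - f x).
Proof.
move=> sf; apply: (@smooth_on_eq (fun x => -1 * f x)) => [x _|].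
  exact: mulN1r.
by apply: smooth_onM => //; exact: smooth_on_cst.
Qed.

Lemma smooth_onX f n : smooth_on A f -> smooth_on A (fun x => f x ^+ n).
Proof.
move=> sf; elim: n => [|n IH]; first exact: smooth_on_cst.
apply: (@smooth_on_eq (fun x => f x * f x ^+ n)) => [x _|].
  by rewrite exprS.
exact: smooth_onM.
Qed.

(** The derivative of 1/f is -(1/f)(1/f) f', so 1/f at order k+1 reduces to 1/f at order k and
    products. *)
Lemma Ck_onV k f : (forall x, A x -> f x != 0) -> Ck_on k A f ->
  Ck_on k A (fun x => (f x)^-1).
Proof.
move=> f0; elim: k => [|k IH].
  by move=> cf x Ax; apply: cvgV; [exact: f0|exact: cf].
move=> cf; have [df Df] := cf; split=> [x Ax|v].
  by apply: differentiableV; [exact: df|exact: f0].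
apply: (@Ck_on_eq _ _ _ k A (fun x => (-1 * ((f x)^-1 * (f x)^-1)) * 'D_v f x) _ oA).
  move=> x; rewrite inE => Ax; rewrite deriveV; [|exact: f0|exact/diff_derivable/df].
  by rewrite mulN1r expr2 invfM.
have cV := IH (Ck_on_pred cf).
apply: Ck_onM; last exact: Df.
apply: Ck_onM; first exact: Ck_on_cst.
exact: Ck_onM.
Qed.

Lemma smooth_onV f : (forall x, A x -> f x != 0) -> smooth_on A f ->
  smooth_on A (fun x => (f x)^-1).
Proof. by move=> f0 sf k; exact: Ck_onV. Qed.

Lemma smooth_on_sum (I : Type) (r : seq I) (P : pred I) (F : I -> V -> R) :
  (forall i, smooth_on A (F i)) ->
  smooth_on A (fun x => \sum_(i <- r | P i) F i x).
Proof.
move=> sF; elim: r => [|i r IH].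
  apply: (@smooth_on_eq (fun=> 0)); last exact: smooth_on_cst.
  by move=> x _; rewrite big_nil.
case: (boolP (P i)) => Pi.
  apply: (@smooth_on_eq (fun x => F i x + \sum_(i <- r | P i) F i x)).
    by move=> x _; rewrite big_cons Pi.
  exact: smooth_onD.
apply: smooth_on_eq IH => x _; by rewrite big_cons (negbTE Pi).
Qed.

Lemma smooth_on_prod (I : Type) (r : seq I) (P : pred I) (F : I -> V -> R) :
  (forall i, smooth_on A (F i)) ->
  smooth_on A (fun x => \prod_(i <- r | P i) F i x).
Proof.
move=> sF; elim: r => [|i r IH].
  apply: (@smooth_on_eq (fun=> 1)); last exact: smooth_on_cst.
  by move=> x _; rewrite big_nil.
case: (boolP (P i)) => Pi.
  apply: (@smooth_on_eq (fun x => F i x * \prod_(i <- r | P i) F i x)).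
    by move=> x _; rewrite big_cons Pi.
  exact: smooth_onM.
apply: smooth_on_eq IH => x _; by rewrite big_cons (negbTE Pi).
Qed.

Lemma smooth_on_det n (M : V -> 'M[R]_n) :
  (forall i j, smooth_on A (fun x => M x i j)) ->
  smooth_on A (fun x => \det (M x)).
Proof.
move=> sM; rewrite /determinant; apply: smooth_on_sum => s.
by apply: smooth_onM; [exact: smooth_on_cst|exact: smooth_on_prod].
Qed.

(** Cramer's rule: an entry of the inverse is a cofactor divided by the determinant, both polynomial
    in the entries of M. *)
Lemma smooth_on_invmx n (M : V -> 'M[R]_n) i j :
  (forall x, A x -> M x \in unitmx) ->
  (forall i j, smooth_on A (fun x => M x i j)) ->
  smooth_on A (fun x => invmx (M x) i j).
Proof.
move=> uM sM.
apply: (@smooth_on_eq (fun x => (\det (M x))^-1 * cofactor (M x) j i)).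
  by move=> x; rewrite inE => Ax; rewrite /invmx uM// !mxE.
apply: smooth_onM.
  apply: smooth_onV; last exact: smooth_on_det.
  by move=> x Ax; have := uM x Ax; rewrite unitmxE unitfE.
apply: smooth_onM; first exact: smooth_on_cst.
apply: smooth_on_det => k l.
rewrite (_ : (fun x => _) = (fun x => M x (lift j k) (lift i l)))//.
by apply/funext => x; rewrite !mxE.
Qed.

Lemma derive_onD f g x v : smooth_on A f -> smooth_on A g -> A x ->
  'D_v (fun x => f x + g x) x = 'D_v f x + 'D_v g x.
Proof. by move=> sf sg Ax; rewrite deriveD//; exact: smooth_on_derivable. Qed.

Lemma derive_onM f g x v : smooth_on A f -> smooth_on A g -> A x ->
  'D_v (fun x => f x * g x) x = 'D_v f x * g x + f x * 'D_v g x.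
Proof.
move=> sf sg Ax; rewrite deriveM; [|exact: smooth_on_derivable..].
by rewrite addrC [g x *: _]mulrC.
Qed.

Lemma derive_on_sum (I : Type) (r : seq I) (F : I -> V -> R) x v :
  (forall i, smooth_on A (F i)) -> A x ->
  'D_v (fun x => \sum_(i <- r) F i x) x = \sum_(i <- r) 'D_v (F i) x.
Proof.
move=> sF Ax; elim: r => [|i r IH].
  rewrite big_nil (_ : (fun x => _) = fun=> 0) ?derive_cst//.
  by apply/funext => y; rewrite big_nil.
rewrite big_cons -IH -derive_onD//; last exact: smooth_on_sum.
by congr ('D_v _ x); apply/funext => y; rewrite big_cons.
Qed.

End RealValued.

(** * Symmetry of second derivatives *)

Section Schwarz.
Variables (R : realType) (V : normedModType R) (A : set V).
Hypothesis oA : open A.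
Implicit Types H : V -> R.

(** Restriction to a line turns a directional derivative into an ordinary one, to which the mean
    value theorem applies. *)
Lemma is_derive_line H x v (s : R) : derivable H (s *: v + x) v ->
  is_derive s 1 (fun s : R => H (s *: v + x)) ('D_v H (s *: v + x)).
Proof.
have E : (fun h : R => h^-1 *: (((fun s : R => H (s *: v + x)) \o shift s)
      (h *: 1) - H (s *: v + x)))
    = fun h : R => h^-1 *: ((H \o shift (s *: v + x)) (h *: v) - H (s *: v + x)).
  by apply/funext => h /=; rewrite [h%:A]mulr1 scalerDl addrA.
by move=> dH; split; rewrite /derivable /derive E.
Qed.

(** Two applications of the mean value theorem: to the increment of H along w as a function of s,
    then to 'D_v H along w at the intermediate s. *)
Lemma second_difference H x v w (t : R) : smooth_on A H -> 0 < t ->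
  (forall s r : R, 0 <= s <= t -> 0 <= r <= t -> A (s *: v + (r *: w + x))) ->
  exists s, exists r, [/\ 0 <= s <= t, 0 <= r <= t &
    H (t *: v + (t *: w + x)) - H (t *: v + x) - H (t *: w + x) + H x =
    'D_w ('D_v H) (s *: v + (r *: w + x)) * t * t].
Proof.
move=> sH t0 sub.
have sDH := smooth_on_derive v sH.
have tt : 0 <= t <= t by rewrite ltW/=.
have zt : 0 <= (0 : R) <= t by rewrite lexx ltW.
have sub0 s : 0 <= s <= t -> A (s *: v + x).
  by move=> st; have := sub s 0 st zt; rewrite scale0r add0r.
pose phi s := H (s *: v + (t *: w + x)) - H (s *: v + x).
have dphi s : 0 <= s <= t -> is_derive s 1 phi
    ('D_v H (s *: v + (t *: w + x)) - 'D_v H (s *: v + x)).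
  move=> st; apply: is_deriveB; apply: is_derive_line;
    apply: smooth_on_derivable sH _; [exact: sub|exact: sub0].
have dphi' s : s \in `]0, t[%R -> is_derive s 1 phi
    ('D_v H (s *: v + (t *: w + x)) - 'D_v H (s *: v + x)).
  by rewrite in_itv/= => /andP[s0 st]; apply: dphi; rewrite !ltW.
have cphi : {within `[0, t], continuous phi}.
  by apply: derivable_within_continuous => s; rewrite in_itv/= => st;
    have [] := dphi s st.
have [s st Es] := MVT t0 dphi' cphi.
have {}st : 0 <= s <= t by move: st; rewrite in_itv/= => /andP[? ?]; rewrite !ltW.
pose psi r := 'D_v H (r *: w + (s *: v + x)).
have dpsi r : 0 <= r <= t -> is_derive r 1 psi
    ('D_w ('D_v H) (r *: w + (s *: v + x))).
  by move=> rt; apply: is_derive_line; apply: smooth_on_derivable sDH _;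
    rewrite addrCA; exact: sub.
have dpsi' r : r \in `]0, t[%R -> is_derive r 1 psi
    ('D_w ('D_v H) (r *: w + (s *: v + x))).
  by rewrite in_itv/= => /andP[r0 rt]; apply: dpsi; rewrite !ltW.
have cpsi : {within `[0, t], continuous psi}.
  by apply: derivable_within_continuous => r; rewrite in_itv/= => rt;
    have [] := dpsi r rt.
have [r rt Er] := MVT t0 dpsi' cpsi.
have {}rt : 0 <= r <= t by move: rt; rewrite in_itv/= => /andP[? ?]; rewrite !ltW.
exists s, r; split=> //.
move: Es Er; rewrite /phi /psi !scale0r !add0r !subr0 (addrCA (t *: w)) => Es Er.
rewrite (addrCA (s *: v)) -Er -Es; ring.
Qed.

Lemma near_parallelogram (P : set V) x v w : nbhs x P ->
  exists2 t : R, 0 < t & forall s r : R, 0 <= s <= t -> 0 <= r <= t ->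
    P (s *: v + (r *: w + x)).
Proof.
move=> /nbhs_ballP[d /= d0 B].
(* The summand 1 keeps m positive when v = w = 0; with t = d/(2m) the displacement s v + r w has
   norm at most t m = d/2 < d. *)
pose m := `|v| + `|w| + 1.
have m0 : 0 < m by rewrite ltr_wpDl// addr_ge0.
pose t := d / (m * 2).
have t0 : 0 < t by rewrite divr_gt0// mulr_gt0.
exists t => // s r /andP[s0 st] /andP[r0 rt]; apply: B.
rewrite -ball_normE /ball_ /= addrA opprD addrCA subrr addr0 normrN.
apply: (le_lt_trans (ler_normD _ _)).
rewrite !normrZ (ger0_norm s0) (ger0_norm r0).
have sa : s * `|v| <= t * `|v| by rewrite ler_wpM2r.
have rb : r * `|w| <= t * `|w| by rewrite ler_wpM2r.
apply: (le_lt_trans (lerD sa rb)); rewrite -mulrDr.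
apply: (@le_lt_trans _ _ (t * m)).
  by rewrite ler_pM2l// lerDl.
by rewrite /t invfM mulrA mulrAC divfK ?gt_eqF// ltr_pdivrMr// ltr_pMr// ltr1n.
Qed.

(** The limiting half of Schwarz's theorem: if K1 and K2 share a value, possibly at different
    points, in every small parallelogram at x, continuity makes them agree at x. *)
Lemma eq_of_parallelograms (K1 K2 : V -> R) x v w : A x ->
  {for x, continuous K1} -> {for x, continuous K2} ->
  (forall t : R, 0 < t ->
    (forall s r : R, 0 <= s <= t -> 0 <= r <= t -> A (s *: v + (r *: w + x))) ->
    exists s1 r1 s2 r2, [/\ 0 <= s1 <= t, 0 <= r1 <= t, 0 <= s2 <= t,
      0 <= r2 <= t & K1 (s1 *: v + (r1 *: w + x)) = K2 (s2 *: v + (r2 *: w + x))]) ->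
  K1 x = K2 x.
Proof.
move=> Ax c1 c2 hK; apply/eqP; rewrite -subr_eq0 -normr_le0.
apply/ler_addgt0Pl => e e0; rewrite addr0.
have e2 : 0 < e / 2 by rewrite divr_gt0.
have /cvgrPdist_lt/(_ _ e2) N1 := c1.
have /cvgrPdist_lt/(_ _ e2) N2 := c2.
have N3 : nbhs x A by exact: open_nbhs_nbhs.
have [t t0 T] := near_parallelogram v w (filterI N3 (filterI N1 N2)).
have [s1 [r1 [s2 [r2 [h1 h2 h3 h4 E]]]]] :=
  hK t t0 (fun s r hs hr => proj1 (T s r hs hr)).
have [_ [n1 _]] := T _ _ h1 h2.
have [_ [_ n2]] := T _ _ h3 h4.
rewrite -(subrKA (K1 (s1 *: v + (r1 *: w + x)))) [X in _ + (X - _)]E.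
by rewrite (le_trans (ler_normD _ _))// [e]splitr lerD// ltW// distrC.
Qed.

(** The second difference is symmetric in v and w, so both mixed derivatives take the same value
    somewhere in each small parallelogram. *)
Lemma derive_comm H x v w : smooth_on A H -> A x ->
  'D_w ('D_v H) x = 'D_v ('D_w H) x.
Proof.
move=> sH Ax.
have cvw a b : {for x, continuous ('D_a ('D_b H))}.
  by have := smooth_on_derive a (smooth_on_derive b sH) 0%N; apply.
apply: (eq_of_parallelograms Ax (cvw w v) (cvw v w) (v := v) (w := w)) => t t0 sub.
have [s [r [st rt E1]]] := second_difference sH t0 sub.
have sub' a b : 0 <= a <= t -> 0 <= b <= t -> A (a *: w + (b *: v + x)).
  by move=> st' rt'; rewrite addrCA; exact: sub.
have [s' [r' [st' rt' E2]]] := second_difference sH t0 sub'.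
(* The second pair is swapped because it was obtained with v and w exchanged. *)
exists s, r, r', s'; split; [exact: st|exact: rt|exact: rt'|exact: st'|].
rewrite (addrCA (r' *: v)).
apply: (mulIf (lt0r_neq0 t0)); apply: (mulIf (lt0r_neq0 t0)).
apply: etrans (esym E1) (etrans _ E2).
rewrite (addrCA (t *: v)); ring.
Qed.

End Schwarz.

(** * Homogeneous functions and partial derivatives *)

Section Homogeneity.
Variables (R : realType) (m n : nat).
Notation TR := ('rV[R]_m * 'rV[R]_n)%type.
Implicit Types (H : TR -> R).

Lemma derive_fibre H (q : TR) (y : 'rV[R]_n) : differentiable H q ->
  'D_(0, y) H q = \sum_j pd2 j H q * y ord0 j.
Proof.
move=> dH; rewrite deriveE//.
have -> : (0, y) = \sum_j y ord0 j *: ((0, delta_mx ord0 j) : TR).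
  rewrite [RHS]surjective_pairing; congr pair.
    rewrite (raddf_sum fst)/= big1// => j _; exact: scaler0.
  by rewrite (raddf_sum snd)/= {1}[y]row_sum_delta.
rewrite linear_sum; apply: eq_bigr => j _.
by rewrite linearZ /pd2 deriveE// mulrC.
Qed.

(** Euler's identity in degree one: the difference quotient along y is constantly H(x,y) once |h| <
    1, a bound that keeps 1 + h positive. *)
Lemma derive_homogeneous1 H (x : 'rV[R]_m) (y : 'rV[R]_n) :
  (forall t : R, 0 < t -> H (x, t *: y) = t * H (x, y)) ->
  'D_(0, y) H (x, y) = H (x, y).
Proof.
move=> hH; apply: cvg_lim => //.
apply: (@cvg_trans _ (cst (H (x, y)) @ (0 : R)^')); last exact: cvg_cst.
apply: near_eq_cvg; near=> h.
have h0 : h != 0 by near: h; exact: nbhs_dnbhs_neq.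
have h1 : 0 < 1 + h.
  have : `|h| < 1 by near: h; exact: dnbhs0_lt.
  by rewrite ltr_norml => /andP[+ _]; rewrite -subr_gt0 opprK addrC.
rewrite /= (_ : h *: _ + _ = (x, (1 + h) *: y)).
  by rewrite hH// mulrDl mul1r addrAC subrr add0r [_ *: _]mulrA mulVf// mul1r.
rewrite [LHS]surjective_pairing /=; congr pair; first by rewrite scaler0 add0r.
by rewrite scalerDl scale1r addrC.
Unshelve. all: by end_near. Qed.

Definition fibre_scale (t : R) (q : TR) : TR := (q.1, t *: q.2).

Lemma fibre_scale_is_linear t : linear (fibre_scale t).
Proof.
move=> k [x y] [x' y']; rewrite [RHS]surjective_pairing; congr pair => /=.
by rewrite scalerDr !scalerA mulrC.
Qed.

HB.instance Definition _ t :=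
  GRing.isLinear.Build R TR TR *:%R (fibre_scale t) (fibre_scale_is_linear t).

(** Differentiating both sides of H(x, t y) = t^2 H(x, y) in y^j gives t H_(;j)(x, t y) = t^2
    H_(;j)(x, y), and t cancels. Openness of A makes the scaling law hold near (x, y). *)
Lemma pd2_homogeneous2 H (A : set 'rV[R]_m) j x y (t : R) : open A ->
  (forall x y (t : R), A x -> 0 < t -> H (x, t *: y) = t ^+ 2 * H (x, y)) ->
  A x -> 0 < t -> differentiable H (x, y) -> differentiable H (x, t *: y) ->
  pd2 j H (x, t *: y) = t * pd2 j H (x, y).
Proof.
move=> oA hH Ax t0 dH dHt; have t0' := lt0r_neq0 t0.
apply: (mulfI t0'); rewrite mulrA -expr2.
set d : TR := (0, delta_mx ord0 j).
have E : fibre_scale t d = t *: d.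
  by rewrite [RHS]surjective_pairing /= scaler0.
have := derive_comp_linear (fibre_scale t) H d (x, y).
rewrite /= E [RHS]deriveE// linearZ -deriveE// /pd2 => <-.
rewrite (@near_eq_derive _ _ _ _ (t ^+ 2 \*: H)).
  by rewrite deriveZ//; exact: diff_derivable.
have Ax' : \forall x \near x, A x by exact: open_nbhs_nbhs.
have : \forall q \near (x, y), A q.1 by exact: (cvg_fst Ax').
by apply: filterS => -[x' y'] /= ?; exact: hH.
Qed.

End Homogeneity.

Lemma open_setX (T U : topologicalType) (A : set T) (B : set U) :
  open A -> open B -> open (A `*` B).
Proof.
move=> oA oB; apply: (@openI _ (fst @^-1` A) (snd @^-1` B)); apply: open_comp => //.
  by move=> q _; exact: cvg_fst.
by move=> q _; exact: cvg_snd.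
Qed.

(** * Linear forms and fibre coordinates *)

Section LinearForms.
Variables (R : realType) (V : normedModType R) (p : {linear V -> R}).
Hypothesis cp : continuous p.

Lemma derive_linear v x : 'D_v p x = p v.
Proof. by rewrite deriveE ?diff_lin//; exact: linear_differentiable. Qed.

Lemma smooth_on_linear (A : set V) : smooth_on A p.
Proof.
case=> [|k]; first by move=> x _; exact: cp.
split=> [x _|v]; first exact: linear_differentiable.
have -> : (fun x => 'D_v p x) = (fun=> p v).
  by apply/funext => x; exact: derive_linear.
exact: Ck_on_cst.
Qed.

End LinearForms.

Section FibreCoordinates.
Variables (R : realType) (m n : nat).
Notation TR := ('rV[R]_m * 'rV[R]_n)%type.

Definition fibre_coord (k : 'I_n) (q : TR) : R := q.2 ord0 k.

Lemma fibre_coord_is_linear k : linear (fibre_coord k : TR -> R^o).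
Proof. by move=> c q r; rewrite /fibre_coord /= !mxE. Qed.

HB.instance Definition _ k :=
  GRing.isLinear.Build R TR R^o *:%R (fibre_coord k) (fibre_coord_is_linear k).

Lemma fibre_coord_continuous k : continuous (fibre_coord k : TR -> R).
Proof.
move=> q; apply: (@continuous_comp _ _ _ snd (fun y : 'rV[R]_n => y ord0 k)).
  exact: cvg_snd.
exact: coord_continuous.
Qed.

Lemma smooth_on_fibre_coord (A : set TR) k : smooth_on A (fun q => q.2 ord0 k).
Proof. exact: (smooth_on_linear (@fibre_coord_continuous k)). Qed.

Lemma pd2_fibre_coord j k (q : TR) : pd2 j (fun q => q.2 ord0 k) q = (j == k)%:R.
Proof.
rewrite [LHS](derive_linear (@fibre_coord_continuous k)).
by rewrite /= /fibre_coord /= mxE eqxx eq_sym.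
Qed.

End FibreCoordinates.

(** * Calculus of partial derivatives on an open set *)

Section PartialDerivatives.
Variables (R : realType) (m n : nat).
Notation TR := ('rV[R]_m * 'rV[R]_n)%type.
Variable A : set TR.
Hypothesis oA : open A.
Implicit Types (f g : TR -> R) (q : TR).

Lemma smooth_pd1 f i : smooth_on A f -> smooth_on A (pd1 i f).
Proof. exact: smooth_on_derive. Qed.

Lemma smooth_pd2 f i : smooth_on A f -> smooth_on A (pd2 i f).
Proof. exact: smooth_on_derive. Qed.

Lemma pd1_eq_on f g i q : (forall r, A r -> f r = g r) -> A q ->
  pd1 i f q = pd1 i g q.
Proof.
move=> fg Aq; apply: (derive_eq_on _ oA); last by rewrite inE.
by move=> r; rewrite inE; exact: fg.
Qed.

Lemma pd2_eq_on f g i q : (forall r, A r -> f r = g r) -> A q ->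
  pd2 i f q = pd2 i g q.
Proof.
move=> fg Aq; apply: (derive_eq_on _ oA); last by rewrite inE.
by move=> r; rewrite inE; exact: fg.
Qed.

Lemma pd1D f g q i : smooth_on A f -> smooth_on A g -> A q ->
  pd1 i (fun q => f q + g q) q = pd1 i f q + pd1 i g q.
Proof. exact: derive_onD. Qed.

Lemma pd2D f g q i : smooth_on A f -> smooth_on A g -> A q ->
  pd2 i (fun q => f q + g q) q = pd2 i f q + pd2 i g q.
Proof. exact: derive_onD. Qed.

Lemma pd1M f g q i : smooth_on A f -> smooth_on A g -> A q ->
  pd1 i (fun q => f q * g q) q = pd1 i f q * g q + f q * pd1 i g q.
Proof. exact: derive_onM. Qed.

Lemma pd2M f g q i : smooth_on A f -> smooth_on A g -> A q ->
  pd2 i (fun q => f q * g q) q = pd2 i f q * g q + f q * pd2 i g q.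
Proof. exact: derive_onM. Qed.

Lemma pd2_cst (c : R) q i : pd2 i (fun=> c) q = 0 :> R.
Proof. exact: derive_cst. Qed.

Lemma pd1_cst (c : R) q i : pd1 i (fun=> c) q = 0 :> R.
Proof. exact: derive_cst. Qed.

Lemma pd2Ml (c : R) f q i : smooth_on A f -> A q ->
  pd2 i (fun q => c * f q) q = c * pd2 i f q.
Proof.
by move=> sf Aq; rewrite pd2M ?pd2_cst ?mul0r ?add0r//; exact: smooth_on_cst.
Qed.

Lemma pd2_sum (I : Type) (r : seq I) (F : I -> TR -> R) q i :
  (forall k, smooth_on A (F k)) -> A q ->
  pd2 i (fun q => \sum_(k <- r) F k q) q = \sum_(k <- r) pd2 i (F k) q.
Proof. exact: derive_on_sum. Qed.

Lemma pd2_comm f q i j : smooth_on A f -> A q ->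
  pd2 i (pd2 j f) q = pd2 j (pd2 i f) q.
Proof. exact: derive_comm. Qed.

End PartialDerivatives.

(** * Functions on a product *)

Section Projections.
Variables (R : realType) (n1 n2 : nat).
Notation TR := ('rV[R]_(n1 + n2) * 'rV[R]_(n1 + n2))%type.
Notation TR1 := ('rV[R]_n1 * 'rV[R]_n1)%type.
Notation TR2 := ('rV[R]_n2 * 'rV[R]_n2)%type.
Notation TRz := ('rV[R]_n1 * 'rV[R]_n2)%type.

(** These maps cut ((x,u),(y,v)) into (x,y), (u,v) and the base point (x,u) where f lives. Being
    linear, they let [derive_comp_linear] compute every partial derivative of a pull-back. *)
Definition pr1 (q : TR) : TR1 := (lsubmx q.1, lsubmx q.2).
Definition pr2 (q : TR) : TR2 := (rsubmx q.1, rsubmx q.2).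
Definition prz (q : TR) : TRz := (lsubmx q.1, rsubmx q.1).

Lemma pr1_is_linear : linear pr1.
Proof. by move=> k q r; rewrite /pr1 /= !linearP. Qed.
Lemma pr2_is_linear : linear pr2.
Proof. by move=> k q r; rewrite /pr2 /= !linearP. Qed.
Lemma prz_is_linear : linear prz.
Proof. by move=> k q r; rewrite /prz /= !linearP. Qed.

HB.instance Definition _ := GRing.isLinear.Build R TR TR1 *:%R pr1 pr1_is_linear.
HB.instance Definition _ := GRing.isLinear.Build R TR TR2 *:%R pr2 pr2_is_linear.
HB.instance Definition _ := GRing.isLinear.Build R TR TRz *:%R prz prz_is_linear.

Lemma lsubmx_fst_continuous : continuous (fun q : TR => lsubmx q.1).
Proof.
move=> q; apply: (@continuous_comp _ _ _ fst lsubmx); first exact: cvg_fst.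
exact: continuous_lsubmx.
Qed.
Lemma lsubmx_snd_continuous : continuous (fun q : TR => lsubmx q.2).
Proof.
move=> q; apply: (@continuous_comp _ _ _ snd lsubmx); first exact: cvg_snd.
exact: continuous_lsubmx.
Qed.
Lemma rsubmx_fst_continuous : continuous (fun q : TR => rsubmx q.1).
Proof.
move=> q; apply: (@continuous_comp _ _ _ fst rsubmx); first exact: cvg_fst.
exact: continuous_rsubmx.
Qed.
Lemma rsubmx_snd_continuous : continuous (fun q : TR => rsubmx q.2).
Proof.
move=> q; apply: (@continuous_comp _ _ _ snd rsubmx); first exact: cvg_snd.
exact: continuous_rsubmx.
Qed.

Lemma pr1_continuous : continuous pr1.
Proof.
by move=> q; exact: (cvg_pair (@lsubmx_fst_continuous q) (@lsubmx_snd_continuous q)).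
Qed.
Lemma pr2_continuous : continuous pr2.
Proof.
by move=> q; exact: (cvg_pair (@rsubmx_fst_continuous q) (@rsubmx_snd_continuous q)).
Qed.
Lemma prz_continuous : continuous prz.
Proof.
by move=> q; exact: (cvg_pair (@lsubmx_fst_continuous q) (@rsubmx_fst_continuous q)).
Qed.

Lemma lsubmx_delta_l (i : 'I_n1) : lsubmx (delta_mx ord0 (lshift n2 i)) = delta_mx ord0 i :> 'rV[R]_n1.
Proof. by apply/rowP => k; rewrite !mxE eq_lshift. Qed.
Lemma rsubmx_delta_l (i : 'I_n1) : rsubmx (delta_mx ord0 (lshift n2 i)) = 0 :> 'rV[R]_n2.
Proof. by apply/rowP => k; rewrite !mxE eq_rlshift. Qed.
Lemma lsubmx_delta_r (i : 'I_n2) : lsubmx (delta_mx ord0 (rshift n1 i)) = 0 :> 'rV[R]_n1.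
Proof. by apply/rowP => k; rewrite !mxE eq_lrshift. Qed.
Lemma rsubmx_delta_r (i : 'I_n2) : rsubmx (delta_mx ord0 (rshift n1 i)) = delta_mx ord0 i :> 'rV[R]_n2.
Proof. by apply/rowP => k; rewrite !mxE eq_rshift. Qed.

Let deltaE := (lsubmx_delta_l, rsubmx_delta_l, lsubmx_delta_r, rsubmx_delta_r).

Section PullBacks.
Variables (H1 : TR1 -> R) (H2 : TR2 -> R) (c : TRz -> R).
Implicit Types (i : 'I_n1) (a : 'I_n2) (q : TR).

Lemma pd1_pr1_l i q : pd1 (lshift n2 i) (fun q => H1 (pr1 q)) q = pd1 i H1 (pr1 q).
Proof. by rewrite /pd1 [LHS](derive_comp_linear pr1 H1) /= /pr1 /= !deltaE linear0. Qed.
Lemma pd1_pr1_r a q : pd1 (rshift n1 a) (fun q => H1 (pr1 q)) q = 0.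
Proof. by rewrite /pd1 [LHS](derive_comp_linear pr1 H1) /= /pr1 /= !deltaE linear0 derive0. Qed.
Lemma pd2_pr1_l i q : pd2 (lshift n2 i) (fun q => H1 (pr1 q)) q = pd2 i H1 (pr1 q).
Proof. by rewrite /pd2 [LHS](derive_comp_linear pr1 H1) /= /pr1 /= !deltaE linear0. Qed.
Lemma pd2_pr1_r a q : pd2 (rshift n1 a) (fun q => H1 (pr1 q)) q = 0.
Proof. by rewrite /pd2 [LHS](derive_comp_linear pr1 H1) /= /pr1 /= !deltaE linear0 derive0. Qed.
Lemma pd1_pr2_l i q : pd1 (lshift n2 i) (fun q => H2 (pr2 q)) q = 0.
Proof. by rewrite /pd1 [LHS](derive_comp_linear pr2 H2) /= /pr2 /= !deltaE linear0 derive0. Qed.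
Lemma pd1_pr2_r a q : pd1 (rshift n1 a) (fun q => H2 (pr2 q)) q = pd1 a H2 (pr2 q).
Proof. by rewrite /pd1 [LHS](derive_comp_linear pr2 H2) /= /pr2 /= !deltaE linear0. Qed.
Lemma pd2_pr2_l i q : pd2 (lshift n2 i) (fun q => H2 (pr2 q)) q = 0.
Proof. by rewrite /pd2 [LHS](derive_comp_linear pr2 H2) /= /pr2 /= !deltaE linear0 derive0. Qed.
Lemma pd2_pr2_r a q : pd2 (rshift n1 a) (fun q => H2 (pr2 q)) q = pd2 a H2 (pr2 q).
Proof. by rewrite /pd2 [LHS](derive_comp_linear pr2 H2) /= /pr2 /= !deltaE linear0. Qed.
Lemma pd1_prz_l i q : pd1 (lshift n2 i) (fun q => c (prz q)) q = pd1 i c (prz q).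
Proof. by rewrite /pd1 [LHS](derive_comp_linear prz c) /= /prz /= !deltaE. Qed.
(** Both components of [TRz] are base points: for a function of (x,u), d/du^alpha is [pd2 a],
    although it is a base derivative on the product. *)
Lemma pd1_prz_r a q : pd1 (rshift n1 a) (fun q => c (prz q)) q = pd2 a c (prz q).
Proof. by rewrite /pd1 /pd2 [LHS](derive_comp_linear prz c) /= /prz /= !deltaE. Qed.
Lemma pd2_prz k q : pd2 k (fun q => c (prz q)) q = 0.
Proof. by rewrite /pd2 [LHS](derive_comp_linear prz c) /= /prz /= !linear0 derive0. Qed.

End PullBacks.
End Projections.

#[local] Opaque derive pd1 pd2.

Ltac smooth :=
  match goal with
  | |- smooth_on _ _ => solve [auto 2]
  | |- smooth_on _ (fun _ => ?c) => apply: smooth_on_cst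
  | |- smooth_on _ _ => solve [apply: smooth_on_fibre_coord]
  | oA : open ?A |- smooth_on ?A (fun q => @?f q + @?g q) =>
      apply: (@smooth_onD _ _ A oA f g); smooth
  | oA : open ?A |- smooth_on ?A (fun q => @?f q * @?g q) =>
      apply: (@smooth_onM _ _ A oA f g); smooth
  | oA : open ?A |- smooth_on ?A (fun q => - @?f q) =>
      apply: (@smooth_onN _ _ A oA f); smooth
  | |- smooth_on _ (pd2 _ _) => apply: smooth_pd2; smooth
  | |- smooth_on _ (pd1 _ _) => apply: smooth_pd1; smooth
  | |- smooth_on _ (fun q => pd2 ?i ?f q) => apply: (@smooth_pd2 _ _ _ _ f i); smooth
  | |- smooth_on _ (fun q => pd1 ?i ?f q) => apply: (@smooth_pd1 _ _ _ _ f i); smooth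
  | oA : open ?A |- smooth_on ?A _ => apply: (smooth_on_sum oA) => ?; smooth
  end.

(* [done] must not be run on an equation between distinct partial derivatives:
   conversion unfolds them down to limits and practically diverges.  So only the
   side conditions are attacked here, and [atoms] abstracts such terms before
   [ring] or [field] compares them. *)
Ltac side :=
  lazymatch goal with
  | |- _ = _ => idtac
  | |- smooth_on _ _ => smooth
  | |- forall _, smooth_on _ _ => move=> ?; smooth
  | |- _ => assumption
  end.

Ltac atoms :=
  repeat match goal with
  | |- context [pd2 ?i ?f ?q] => generalize (pd2 i f q); intro
  | |- context [pd1 ?i ?f ?q] => generalize (pd1 i f q); intro
  | |- context [low_y ?F ?i ?q] => generalize (low_y F i q); intro
  | |- context [fund ?F ?i ?j ?q] => generalize (fund F i j q); intro
  | |- context [fund_inv ?F ?i ?j ?q] => generalize (fund_inv F i j q); intro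
  | |- context [mean_cartan ?F ?i ?q] => generalize (mean_cartan F i q); intro
  end.

(** * Vanishing Hessians and the divergence form of E *)

Lemma hess_cst (R : realType) m n (c : R) i j (q : 'rV[R]_m * 'rV[R]_n) :
  pd2 i (pd2 j (fun=> c)) q = 0 :> R.
Proof.
by rewrite (_ : pd2 j _ = fun=> 0) ?pd2_cst//; apply/funext => r; exact: pd2_cst.
Qed.

Lemma hess_fibre_coord (R : realType) m n k i j (q : 'rV[R]_m * 'rV[R]_n) :
  pd2 i (pd2 j (fun q : 'rV[R]_m * 'rV[R]_n => q.2 ord0 k)) q = 0.
Proof.
rewrite (_ : pd2 j _ = fun=> (j == k)%:R) ?pd2_cst//.
by apply/funext => r; exact: pd2_fibre_coord.
Qed.

(** The contracted derivative in [berwald] is the innermost one, so linearity alone moves the sum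
    inside the two outer derivatives. *)
Lemma mean_berwald_div (R : realType) n (F : 'rV[R]_n * 'rV[R]_n -> R) A j k q :
  open A -> (forall m, smooth_on A (spray F m)) -> A q ->
  mean_berwald F j k q =
  2^-1 * pd2 j (pd2 k (fun q => \sum_m pd2 m (spray F m) q)) q.
Proof.
move=> oA sG Aq; have sp m := smooth_pd2 m (sG m).
rewrite /mean_berwald /berwald -(pd2_sum oA _ _ (fun m => smooth_pd2 k (sp m)) Aq).
have E r : A r -> pd2 k (fun q => \sum_m pd2 m (spray F m) q) r
    = \sum_m pd2 k (pd2 m (spray F m)) r.
  by move=> Ar; rewrite (pd2_sum oA _ _ sp Ar).
by rewrite (pd2_eq_on oA j E Aq).
Qed.

Lemma sum_delta (R : realType) n (f : 'I_n -> R) i :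
  \sum_j (i == j)%:R * f j = f i.
Proof.
rewrite (bigD1 i)//= eqxx mul1r big1 ?addr0// => j /negbTE ji.
by rewrite eq_sym ji mul0r.
Qed.

(** * Local Finsler geometry *)

Section LocalFinsler.
Variables (R : realType) (n : nat).
Notation TR := ('rV[R]_n * 'rV[R]_n)%type.
Variables (D : set 'rV[R]_n) (F : TR -> R).
Hypothesis oD : open D.
Let A : set TR := D `*` [set y | y != 0].
Hypothesis sF : smooth_on A F.
Hypothesis hF : forall x y (t : R), D x -> 0 < t -> F (x, t *: y) = t * F (x, y).
Hypothesis pF : forall x y (w : 'rV[R]_n), D x -> y != 0 -> w != 0 ->
  0 < \sum_i \sum_j fund F i j (x, y) * w ord0 i * w ord0 j.

Lemma open_slit : open A.
Proof.
apply: open_setX => //; rewrite (_ : [set _ | _] = ~` [set 0]); last first.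
  by apply/seteqP; split => y /= /eqP.
by apply: closed_openC; exact/accessible_closed_set1/hausdorff_accessible/norm_hausdorff.
Qed.
Let oA := open_slit.

Lemma smooth_sqF : smooth_on A (sqF F).
Proof. exact: smooth_onX. Qed.
Let sL := smooth_sqF.

Lemma smooth_fund i j : smooth_on A (fund F i j).
Proof. rewrite /fund; smooth. Qed.
Let sg := smooth_fund.

(** A nonzero row vector w with w g = 0 would annihilate the quadratic form, contradicting positive
    definiteness. *)
Lemma fund_unit q : A q -> fund_mx F q \in unitmx.
Proof.
case: q => x y [/= Dx y0]; rewrite unitmxE unitfE; apply/negP => /det0P[w w0 wM].
have := pF Dx y0 w0; rewrite exchange_big/= big1 ?ltxx// => j _.
have /rowP/(_ j) := wM; rewrite !mxE => E.
rewrite -mulr_suml; apply/eqP; rewrite mulf_eq0; apply/orP; left; apply/eqP.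
by rewrite -[RHS]E; apply: eq_bigr => i _; rewrite !mxE mulrC.
Qed.

Lemma smooth_fund_inv i j : smooth_on A (fund_inv F i j).
Proof.
apply: (@smooth_on_invmx _ _ _ oA _ (fund_mx F) i j fund_unit) => k l.
rewrite (_ : (fun q => _) = fund F k l)//.
by apply/funext => q; rewrite mxE.
Qed.
Let sgi := smooth_fund_inv.

Lemma smooth_spray i : smooth_on A (spray F i).
Proof. rewrite /spray; smooth. Qed.

Lemma smooth_cartan i j k : smooth_on A (cartan F i j k).
Proof. rewrite /cartan; smooth. Qed.
Let sC := smooth_cartan.

Lemma smooth_cartan_uu i j k : smooth_on A (cartan_uu F i j k).
Proof. rewrite /cartan_uu; smooth. Qed.
Let sCuu := smooth_cartan_uu.

Lemma smooth_mean_cartan h : smooth_on A (mean_cartan F h).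
Proof. rewrite /mean_cartan; smooth. Qed.

Lemma smooth_low_y i : smooth_on A (low_y F i).
Proof. rewrite /low_y; smooth. Qed.
Let sy := smooth_low_y.

(** * Euler identities, the inverse fundamental tensor and the Cartan tensor *)

Lemma fund_inv_fund i j q : A q ->
  \sum_l fund_inv F i l q * fund F l j q = (i == j)%:R.
Proof.
move=> Aq; have := mulVmx (fund_unit Aq) => /matrixP/(_ i j).
by rewrite !mxE => <-; apply: eq_bigr => l _; rewrite !mxE.
Qed.

Lemma fund_fund_inv i j q : A q ->
  \sum_l fund F i l q * fund_inv F l j q = (i == j)%:R.
Proof.
move=> Aq; have := mulmxV (fund_unit Aq) => /matrixP/(_ i j).
by rewrite !mxE => <-; apply: eq_bigr => l _; rewrite !mxE.
Qed.

Lemma fundC i j q : A q -> fund F i j q = fund F j i q.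
Proof. by move=> Aq; rewrite /fund (pd2_comm oA _ _ sL Aq). Qed.

Lemma fund_invC i j q : A q -> fund_inv F i j q = fund_inv F j i q.
Proof.
move=> Aq; rewrite /fund_inv -[in LHS](trmxK (fund_mx F q)) -trmx_inv mxE.
congr (invmx _ _ _); apply/matrixP => k l; rewrite !mxE; exact: fundC.
Qed.

Lemma pd2_fundC i j k q : A q -> pd2 k (fund F i j) q = pd2 k (fund F j i) q.
Proof.
by move=> Aq; apply: (pd2_eq_on oA _ _ Aq) => r; exact: fundC.
Qed.

(** With [fundC] this gives the total symmetry of C_ijk, a third fibre derivative of F^2. *)
Lemma pd2_fund_swap i j k q : A q -> pd2 k (fund F i j) q = pd2 j (fund F i k) q.
Proof.
move=> Aq; rewrite /fund (pd2Ml (A := A)); side.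
rewrite [RHS](pd2Ml (A := A)); side.
by rewrite (pd2_comm oA k j (smooth_pd2 i sL) Aq).
Qed.

Lemma sqF_homogeneous x y (t : R) : D x -> 0 < t ->
  sqF F (x, t *: y) = t ^+ 2 * sqF F (x, y).
Proof. by move=> Dx t0; rewrite /sqF hF// exprMn. Qed.

(** Euler's identity for L_(;i), which is homogeneous of degree one because L has degree two. *)
Lemma low_yE i q : A q -> low_y F i q = 2^-1 * pd2 i (sqF F) q.
Proof.
case: q => x y Aq; have [/= Dx y0] := Aq; have [dL _] := sL 1%N.
have [ddL _] := smooth_pd2 i sL 1%N.
rewrite -[in RHS](@derive_homogeneous1 _ _ _ (pd2 i (sqF F)) x y); last first.
  move=> t t0; apply: (pd2_homogeneous2 _ oD sqF_homogeneous) => //; apply: dL => //.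
  by split=> //=; rewrite scaler_eq0 negb_or y0 gt_eqF.
rewrite derive_fibre; last exact: ddL.
rewrite mulr_sumr; apply: eq_bigr => j _; by rewrite /fund mulrA.
Qed.

Lemma pd2_low_y i j q : A q -> pd2 j (low_y F i) q = fund F i j q.
Proof.
move=> Aq; rewrite (pd2_eq_on oA (g := fun q => 2^-1 * pd2 i (sqF F) q) j _ Aq).
  by rewrite (pd2Ml (A := A)); side.
exact: low_yE.
Qed.

(** The product rule applied to y_i = g_ij y^j gives g_ik plus this sum, while [pd2_low_y] gives
    g_ik alone. *)
Lemma pd2_fund_contract i k q : A q ->
  \sum_j pd2 k (fund F i j) q * q.2 ord0 j = 0.
Proof.
move=> Aq; apply: (@addIr _ (fund F i k q)).
rewrite add0r -[in RHS](pd2_low_y _ _ Aq) /low_y (pd2_sum oA); side.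
under [in RHS]eq_bigr => j _ do
  rewrite (pd2M _ (smooth_fund _ _) (smooth_on_fibre_coord _ _) Aq) pd2_fibre_coord
    [_ * (_ == _)%:R]mulrC.
by rewrite big_split/= -[in LHS](sum_delta (fun j => fund F i j q)).
Qed.

Lemma raise_low_y i q : A q -> \sum_l fund_inv F i l q * low_y F l q = q.2 ord0 i.
Proof.
move=> Aq.
transitivity (\sum_j (\sum_l fund_inv F i l q * fund F l j q) * q.2 ord0 j).
  under [RHS]eq_bigr => j _ do rewrite mulr_suml.
  rewrite [RHS]exchange_big/=; apply: eq_bigr => l _; rewrite mulr_sumr.
  by apply: eq_bigr => j _; rewrite mulrA.
under eq_bigr => j _ do rewrite (fund_inv_fund _ _ Aq).
exact: sum_delta.
Qed.

Lemma pd2_sqF i q : A q -> pd2 i (sqF F) q = 2 * low_y F i q.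
Proof. by move=> Aq; rewrite (low_yE _ Aq) mulrA mulfV ?mul1r// pnatr_eq0. Qed.

(** Differentiate g^is g_sj = delta and contract with g^jl, which isolates the derivative of
    g^il. *)
Lemma pd2_fund_inv i l k q : A q -> pd2 k (fund_inv F i l) q =
  - \sum_s \sum_t fund_inv F i s q * pd2 k (fund F s t) q * fund_inv F t l q.
Proof.
move=> Aq.
have E j : \sum_s pd2 k (fund_inv F i s) q * fund F s j q
    = - \sum_s fund_inv F i s q * pd2 k (fund F s j) q.
  apply/eqP; rewrite -addr_eq0 -big_split/=; apply/eqP.
  under eq_bigr => s _ do rewrite -(pd2M _ (sgi i s) (sg s j) Aq).
  rewrite -(pd2_sum oA); side.
  rewrite (pd2_eq_on oA (g := fun=> (i == j)%:R) k _ Aq) ?pd2_cst//.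
  by move=> r; exact: fund_inv_fund.
transitivity (\sum_j (\sum_s pd2 k (fund_inv F i s) q * fund F s j q) * fund_inv F j l q).
  transitivity (\sum_s (l == s)%:R * pd2 k (fund_inv F i s) q).
    by rewrite sum_delta.
  under [RHS]eq_bigr => j _ do rewrite mulr_suml.
  rewrite [RHS]exchange_big/=; apply: eq_bigr => s _.
  rewrite eq_sym -(fund_fund_inv _ _ Aq) mulr_suml; apply: eq_bigr => j _.
  by rewrite mulrC mulrA.
under eq_bigr => j _ do rewrite E mulNr mulr_suml.
by rewrite sumrN exchange_big.
Qed.

Lemma div_fund_inv l q : A q ->
  \sum_i pd2 i (fund_inv F i l) q = - 2 * mean_cartan F l q.
Proof.
move=> Aq; rewrite mulNr mulr_sumr -sumrN; apply: eq_bigr => i _.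
rewrite (pd2_fund_inv _ _ _ Aq); congr (- _); rewrite mulr_sumr; apply: eq_bigr => s _.
rewrite mulr_sumr; apply: eq_bigr => t _.
by rewrite (fund_invC t _ Aq) /cartan; field.
Qed.

(** The raised index turns y_i back into y^s, and C_stk y^s = 0 by [pd2_fund_contract]. *)
Lemma cartan_uu_low_y j k q : A q ->
  \sum_i cartan_uu F i j k q * low_y F i q = 0.
Proof.
move=> Aq.
transitivity (\sum_s \sum_t (\sum_i fund_inv F s i q * low_y F i q) *
    (fund_inv F j t q * cartan F s t k q)).
  under eq_bigr => i _ do rewrite mulr_suml.
  rewrite exchange_big/=; apply: eq_bigr => s _.
  under eq_bigr => i _ do rewrite mulr_suml.
  rewrite exchange_big/=; apply: eq_bigr => t _.
  rewrite mulr_suml; apply: eq_bigr => i _; rewrite (fund_invC i _ Aq); ring.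
rewrite exchange_big/= big1// => t _.
under eq_bigr => s _ do rewrite (raise_low_y _ Aq).
transitivity (fund_inv F j t q * 2^-1 * \sum_s pd2 k (fund F t s) q * q.2 ord0 s).
  rewrite mulr_sumr; apply: eq_bigr => s _.
  rewrite /cartan; rewrite -> (pd2_fundC s t k Aq).
  by rewrite mulrC !mulrA.
by rewrite (pd2_fund_contract _ _ Aq) mulr0.
Qed.

Lemma pd2_cartan_uu_low_y nu al be q : A q ->
  \sum_ga pd2 be (cartan_uu F ga nu al) q * low_y F ga q = - cartan_u F nu al be q.
Proof.
move=> Aq; transitivity (- \sum_ga cartan_uu F ga nu al q * fund F ga be q).
  apply/eqP; rewrite -addr_eq0 -big_split/=; apply/eqP.
  under eq_bigr => ga _ do
    rewrite -(pd2_low_y _ _ Aq) -(pd2M _ (sCuu _ _ _) (sy ga) Aq).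
  rewrite -(pd2_sum oA); side.
  rewrite (pd2_eq_on oA (g := fun=> 0) be _ Aq) ?pd2_cst//.
  by move=> r; exact: cartan_uu_low_y.
congr (- _).
(* Contracting with g_(gamma beta) lowers the raised index gamma to beta. *)
transitivity (\sum_s \sum_t (\sum_ga fund_inv F s ga q * fund F ga be q) *
    (fund_inv F nu t q * cartan F s t al q)).
  under eq_bigr => i _ do rewrite mulr_suml.
  rewrite exchange_big/=; apply: eq_bigr => s _.
  under eq_bigr => i _ do rewrite mulr_suml.
  rewrite exchange_big/=; apply: eq_bigr => t _.
  rewrite mulr_suml; apply: eq_bigr => i _; rewrite (fund_invC i _ Aq); ring.
transitivity (\sum_s (be == s)%:R * \sum_t fund_inv F nu t q * cartan F s t al q).
  apply: eq_bigr => s _; rewrite mulr_sumr; apply: eq_bigr => t _.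
  by rewrite (fund_inv_fund _ _ Aq) eq_sym.
rewrite sum_delta; apply: eq_bigr => t _.
(* Total symmetry of C carries beta from the first slot to the last. *)
rewrite /cartan; rewrite -> (pd2_fundC be t al Aq).
by rewrite -> (pd2_fund_swap t be al Aq).
Qed.

Let sI := smooth_mean_cartan.

(** This is the coefficient of f^-1 f_b in the spray. The product v^b v^a contributes (n + 1) v^b;
    the term - g^ab v_a, coming from the derivative of L, removes one copy, and the divergence of
    g^ab supplies I^b L. *)
Lemma div_radial_minus_raised b q : A q ->
  \sum_a pd2 a (fun q => q.2 ord0 b * q.2 ord0 a
                 + - 2^-1 * (fund_inv F a b q * sqF F q)) q =
  n%:R * q.2 ord0 b + mean_cartan F b q * sqF F q.
Proof.
move=> Aq.
have E a : pd2 a (fun q => q.2 ord0 b * q.2 ord0 a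
                 + - 2^-1 * (fund_inv F a b q * sqF F q)) q =
    (b == a)%:R * q.2 ord0 a + q.2 ord0 b
    + - 2^-1 * (pd2 a (fund_inv F a b) q * sqF F q)
    + - (fund_inv F b a q * low_y F a q).
  rewrite (pd2D (A := A)); side.
  rewrite (pd2Ml (A := A)); side.
  rewrite (pd2M (A := A)); side.
  rewrite (pd2M a (sgi a b) sL Aq) !pd2_fibre_coord eqxx mulr1 (pd2_sqF a Aq).
  rewrite (fund_invC a b Aq) (eq_sym a b).
  by generalize (pd2 a (fund_inv F a b) q) => X; field.
rewrite (eq_bigr _ (fun a _ => E a)) !big_split/= sumrN sum_delta (raise_low_y _ Aq).
rewrite sumr_const card_ord -mulr_sumr -mulr_suml (div_fund_inv _ Aq).
by rewrite -mulr_natl; field.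
Qed.

(** The linear term dies, and L_(;a) = 2 v_a with v_(a;b) = g_ab produces the rest; multiplied by
    1/2 f^-1 f_nu it gives all terms of E_(alpha beta) with a derivative of f along M_2. *)
Lemma hess_mean_cartan_sqF (c : R) nu al be q : A q ->
  pd2 al (pd2 be (fun q => c * q.2 ord0 nu + mean_cartan F nu q * sqF F q)) q =
  pd2 be (pd2 al (mean_cartan F nu)) q * sqF F q
  + 2 * (pd2 al (mean_cartan F nu) q * low_y F be q
         + pd2 be (mean_cartan F nu) q * low_y F al q
         + mean_cartan F nu q * fund F al be q).
Proof.
move=> Aq.
pose G r := c * (be == nu)%:R
  + (pd2 be (mean_cartan F nu) r * sqF F r + 2 * (mean_cartan F nu r * low_y F be r)).
rewrite (pd2_eq_on oA (g := G) al _ Aq); last first.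
  move=> r Ar; rewrite (pd2D (A := A)); side.
  rewrite (pd2Ml (A := A)); side.
  rewrite (pd2M be (sI nu) sL Ar) pd2_fibre_coord (pd2_sqF be Ar) /G.
  by atoms; ring.
rewrite /G (pd2D (A := A)); side.
rewrite pd2_cst add0r (pd2D (A := A)); side.
rewrite (pd2Ml (A := A)); side.
rewrite (pd2M al (sI nu) (sy be) Aq) (pd2M al (smooth_pd2 be (sI nu)) sL Aq).
rewrite -> (pd2_comm oA al be (sI nu) Aq).
rewrite (pd2_sqF al Aq) (pd2_low_y be al Aq) (fundC be al Aq).
by atoms; ring.
Qed.

End LocalFinsler.

(** * Twisted products *)

Section Separated.
Variables (R : realType) (n1 n2 : nat).
Notation TR := ('rV[R]_(n1 + n2) * 'rV[R]_(n1 + n2))%type.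
Notation TR1 := ('rV[R]_n1 * 'rV[R]_n1)%type.
Notation TR2 := ('rV[R]_n2 * 'rV[R]_n2)%type.
Notation TRz := ('rV[R]_n1 * 'rV[R]_n2)%type.
Variables (D1 : set 'rV[R]_n1) (D2 : set 'rV[R]_n2).
Hypotheses (oD1 : open D1) (oD2 : open D2).
Let A1 : set TR1 := D1 `*` [set y | y != 0].
Let A2 : set TR2 := D2 `*` [set y | y != 0].
Let Az : set TRz := D1 `*` D2.

Definition slit_prod : set TR := (@pr1 R n1 n2 @^-1` A1) `&` (@pr2 R n1 n2 @^-1` A2).
Notation U := slit_prod.

Lemma open_slit_prod : open U.
Proof.
apply: openI; apply: open_comp.
- by move=> q _; exact: pr1_continuous.
- exact: open_slit.
- by move=> q _; exact: pr2_continuous.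
- exact: open_slit.
Qed.

(** Separated products are stable under fibre derivatives, each of which hits only H1 or only H2; a
    base derivative gives one extra term through c. *)
Definition sep (c : TRz -> R) (H1 : TR1 -> R) (H2 : TR2 -> R) (q : TR) : R :=
  c (prz q) * (H1 (pr1 q) * H2 (pr2 q)).

Lemma slit_prod_prz q : U q -> Az (prz q).
Proof. by move=> [[? _] [? _]]; split. Qed.

Lemma smooth_pr1 (H : TR1 -> R) : smooth_on A1 H -> smooth_on U (fun q => H (pr1 q)).
Proof.
move=> sH k; apply: Ck_on_subset (Ck_on_comp_linear (@pr1_continuous R n1 n2) (sH k)).
by move=> q [].
Qed.
Lemma smooth_pr2 (H : TR2 -> R) : smooth_on A2 H -> smooth_on U (fun q => H (pr2 q)).
Proof.
move=> sH k; apply: Ck_on_subset (Ck_on_comp_linear (@pr2_continuous R n1 n2) (sH k)).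
by move=> q [].
Qed.
Lemma smooth_prz (H : TRz -> R) : smooth_on Az H -> smooth_on U (fun q => H (prz q)).
Proof.
move=> sH k; apply: Ck_on_subset (Ck_on_comp_linear (@prz_continuous R n1 n2) (sH k)).
exact: slit_prod_prz.
Qed.

Section SepDerivatives.
Variables (c : TRz -> R) (H1 : TR1 -> R) (H2 : TR2 -> R).
Hypotheses (sc : smooth_on Az c) (s1 : smooth_on A1 H1) (s2 : smooth_on A2 H2).
Let scz := smooth_prz sc.
Let s1' := smooth_pr1 s1.
Let s2' := smooth_pr2 s2.
Let s12 := smooth_onM open_slit_prod s1' s2'.

Lemma smooth_sep : smooth_on U (sep c H1 H2).
Proof. exact: (smooth_onM open_slit_prod scz s12). Qed.

Lemma pd2_sep_l j q : U q ->
  pd2 (lshift n2 j) (sep c H1 H2) q = sep c (pd2 j H1) H2 q.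
Proof.
move=> Uq; rewrite /sep (pd2M _ scz s12 Uq) (pd2M _ s1' s2' Uq).
by rewrite pd2_prz pd2_pr1_l pd2_pr2_l mul0r add0r mulr0 addr0.
Qed.

Lemma pd2_sep_r b q : U q ->
  pd2 (rshift n1 b) (sep c H1 H2) q = sep c H1 (pd2 b H2) q.
Proof.
move=> Uq; rewrite /sep (pd2M _ scz s12 Uq) (pd2M _ s1' s2' Uq).
by rewrite pd2_prz pd2_pr1_r pd2_pr2_r !mul0r !add0r.
Qed.

Lemma pd1_sep_l j q : U q -> pd1 (lshift n2 j) (sep c H1 H2) q =
  sep (pd1 j c) H1 H2 q + sep c (pd1 j H1) H2 q.
Proof.
move=> Uq; rewrite /sep (pd1M _ scz s12 Uq) (pd1M _ s1' s2' Uq).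
by rewrite pd1_prz_l pd1_pr1_l pd1_pr2_l mulr0 addr0.
Qed.

Lemma pd1_sep_r b q : U q -> pd1 (rshift n1 b) (sep c H1 H2) q =
  sep (pd2 b c) H1 H2 q + sep c H1 (pd1 b H2) q.
Proof.
move=> Uq; rewrite /sep (pd1M _ scz s12 Uq) (pd1M _ s1' s2' Uq).
by rewrite pd1_prz_r pd1_pr1_r pd1_pr2_r mul0r add0r.
Qed.

End SepDerivatives.
End Separated.

(** * Fundamental tensor of the twisted product and its inverse *)

Lemma invmx_block_diag_scale (R : fieldType) n1 n2 (M : 'M[R]_n1) (N : 'M[R]_n2) c :
  M \in unitmx -> N \in unitmx -> c != 0 ->
  invmx (block_mx M 0 0 (c *: N)) = block_mx (invmx M) 0 0 (c^-1 *: invmx N).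
Proof.
move=> uM uN c0.
have E : block_mx M 0 0 (c *: N) *m block_mx (invmx M) 0 0 (c^-1 *: invmx N) = 1%:M.
  rewrite mulmx_block !(mulmx0, mul0mx) !(addr0, add0r) mulmxV//.
  by rewrite -scalemxAl -scalemxAr scalerA mulfV// scale1r mulmxV// -scalar_mx_block.
have [u _] := mulmx1_unit E.
by rewrite -[LHS]mulmx1 -E mulmxA mulVmx// mul1mx.
Qed.

Section Twisted.
Variables (R : realType) (n1 n2 : nat).
Notation TR := ('rV[R]_(n1 + n2) * 'rV[R]_(n1 + n2))%type.
Notation TR1 := ('rV[R]_n1 * 'rV[R]_n1)%type.
Notation TR2 := ('rV[R]_n2 * 'rV[R]_n2)%type.
Notation TRz := ('rV[R]_n1 * 'rV[R]_n2)%type.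
Variables (D1 : set 'rV[R]_n1) (D2 : set 'rV[R]_n2).
Hypotheses (oD1 : open D1) (oD2 : open D2).
Notation A1 := (D1 `*` [set y : 'rV[R]_n1 | y != 0]).
Notation A2 := (D2 `*` [set y : 'rV[R]_n2 | y != 0]).
Notation Az := (D1 `*` D2).
Variables (F1 : TR1 -> R) (F2 : TR2 -> R) (f : TRz -> R).
Hypothesis sF1 : smooth_on A1 F1.
Hypothesis pF1 : forall x y (w : 'rV[R]_n1), D1 x -> y != 0 -> w != 0 ->
  0 < \sum_i \sum_j fund F1 i j (x, y) * w ord0 i * w ord0 j.
Hypothesis sF2 : smooth_on A2 F2.
Hypothesis hF2 : forall x y (t : R), D2 x -> 0 < t -> F2 (x, t *: y) = t * F2 (x, y).
Hypothesis pF2 : forall x y (w : 'rV[R]_n2), D2 x -> y != 0 -> w != 0 ->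
  0 < \sum_i \sum_j fund F2 i j (x, y) * w ord0 i * w ord0 j.
Hypothesis sf : smooth_on Az f.
Hypothesis f0 : forall z, Az z -> f z != 0.

Notation F := (twisted_metric F1 F2 f).
Notation L1 := (sqF F1).
Notation L2 := (sqF F2).
Notation U := (slit_prod D1 D2).
Implicit Types q : TR.

Let oA1 : open A1 := open_slit oD1.
Let oA2 : open A2 := open_slit oD2.
Let oAz : open Az := open_setX oD1 oD2.
Let oU : open U := open_slit_prod oD1 oD2.
Let sL1 : smooth_on A1 L1 := smooth_sqF oD1 sF1.
Let sL2 : smooth_on A2 L2 := smooth_sqF oD2 sF2.

Let sfV : smooth_on Az (fun z => (f z)^-1).
Proof. exact: smooth_onV. Qed.

(** Written as a product so that the product rule applies directly. *)
Let f2 z := f z * f z.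
Let sf2 : smooth_on Az f2.
Proof. exact: smooth_onM. Qed.

Let pd1_f2 k z : Az z -> pd1 k f2 z = 2 * (f z * pd1 k f z).
Proof. by move=> zA; rewrite /f2 (pd1M _ sf sf zA); atoms; ring. Qed.

Let pd2_f2 k z : Az z -> pd2 k f2 z = 2 * (f z * pd2 k f z).
Proof. by move=> zA; rewrite /f2 (pd2M _ sf sf zA); atoms; ring. Qed.

Let s1 (V : normedModType R) (A : set V) : smooth_on A (fun=> 1 : R).
Proof. exact: smooth_on_cst. Qed.

Lemma sqF_twisted :
  sqF F = fun q => sep (fun=> 1) L1 (fun=> 1) q + sep f2 (fun=> 1) L2 q.
Proof.
apply/funext => q; rewrite /sqF /twisted_metric sqr_sqrtr.
  by rewrite /sep !mul1r mulr1 /f2 -expr2.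
by apply: addr_ge0; [exact: sqr_ge0|apply: mulr_ge0; exact: sqr_ge0].
Qed.

Lemma pd2_sqF_twisted_l l q : U q ->
  pd2 (lshift n2 l) (sqF F) q = sep (fun=> 1) (pd2 l L1) (fun=> 1) q.
Proof.
move=> Uq; rewrite sqF_twisted.
rewrite (pd2D _ (smooth_sep oD1 oD2 (s1 _) sL1 (s1 _)) (smooth_sep oD1 oD2 sf2 (s1 _) sL2) Uq).
rewrite (pd2_sep_l oD1 oD2 (s1 _) sL1 (s1 _) _ Uq) (pd2_sep_l oD1 oD2 sf2 (s1 _) sL2 _ Uq).
by rewrite [X in _ + X]/sep pd2_cst mul0r mulr0 addr0.
Qed.

Lemma pd2_sqF_twisted_r b q : U q ->
  pd2 (rshift n1 b) (sqF F) q = sep f2 (fun=> 1) (pd2 b L2) q.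
Proof.
move=> Uq; rewrite sqF_twisted.
rewrite (pd2D _ (smooth_sep oD1 oD2 (s1 _) sL1 (s1 _)) (smooth_sep oD1 oD2 sf2 (s1 _) sL2) Uq).
rewrite (pd2_sep_r oD1 oD2 (s1 _) sL1 (s1 _) _ Uq) (pd2_sep_r oD1 oD2 sf2 (s1 _) sL2 _ Uq).
by rewrite [X in X + _]/sep pd2_cst !mulr0 add0r.
Qed.

Lemma fund_twisted_ll i j q : U q ->
  fund F (lshift n2 i) (lshift n2 j) q = fund F1 i j (pr1 q).
Proof.
move=> Uq; rewrite /fund (pd2_eq_on oU _ (pd2_sqF_twisted_l i) Uq).
rewrite (pd2_sep_l oD1 oD2 (s1 _) (smooth_pd2 _ sL1) (s1 _) _ Uq) /sep.
by rewrite mul1r mulr1.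
Qed.

Lemma fund_twisted_lr i b q : U q -> fund F (lshift n2 i) (rshift n1 b) q = 0.
Proof.
move=> Uq; rewrite /fund (pd2_eq_on oU _ (pd2_sqF_twisted_l i) Uq).
rewrite (pd2_sep_r oD1 oD2 (s1 _) (smooth_pd2 _ sL1) (s1 _) _ Uq) /sep.
by rewrite pd2_cst !mulr0.
Qed.

Lemma fund_twisted_rl b i q : U q -> fund F (rshift n1 b) (lshift n2 i) q = 0.
Proof.
move=> Uq; rewrite /fund (pd2_eq_on oU _ (pd2_sqF_twisted_r b) Uq).
rewrite (pd2_sep_l oD1 oD2 sf2 (s1 _) (smooth_pd2 _ sL2) _ Uq) /sep.
by rewrite pd2_cst mul0r !mulr0.
Qed.

Lemma fund_twisted_rr a b q : U q ->
  fund F (rshift n1 a) (rshift n1 b) q = f2 (prz q) * fund F2 a b (pr2 q).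
Proof.
move=> Uq; rewrite /fund (pd2_eq_on oU _ (pd2_sqF_twisted_r a) Uq).
rewrite (pd2_sep_r oD1 oD2 sf2 (s1 _) (smooth_pd2 _ sL2) _ Uq) /sep.
by rewrite mul1r mulrCA.
Qed.

Lemma fund_mx_twisted q : U q -> fund_mx F q =
  block_mx (fund_mx F1 (pr1 q)) 0 0 (f2 (prz q) *: fund_mx F2 (pr2 q)).
Proof.
move=> Uq; apply/matrixP => i j.
case: (split_ordP i) => i' ->; case: (split_ordP j) => j' ->;
  rewrite ?(block_mxEul, block_mxEur, block_mxEdl, block_mxEdr) !mxE.
- exact: fund_twisted_ll.
- exact: fund_twisted_lr.
- exact: fund_twisted_rl.
- exact: fund_twisted_rr.
Qed.

Lemma f_neq0 q : U q -> f (prz q) != 0.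
Proof. by move=> Uq; exact/f0/(slit_prod_prz Uq). Qed.

Lemma invmx_fund_mx_twisted q : U q -> invmx (fund_mx F q) =
  block_mx (invmx (fund_mx F1 (pr1 q))) 0
           0 ((f2 (prz q))^-1 *: invmx (fund_mx F2 (pr2 q))).
Proof.
move=> Uq; rewrite (fund_mx_twisted Uq) invmx_block_diag_scale//.
- exact: (fund_unit pF1 Uq.1).
- exact: (fund_unit pF2 Uq.2).
- by rewrite mulf_neq0// f_neq0.
Qed.

Lemma fund_inv_twisted_ll i j q : U q ->
  fund_inv F (lshift n2 i) (lshift n2 j) q = fund_inv F1 i j (pr1 q).
Proof. by move=> Uq; rewrite /fund_inv invmx_fund_mx_twisted// block_mxEul. Qed.

Lemma fund_inv_twisted_lr i b q : U q ->
  fund_inv F (lshift n2 i) (rshift n1 b) q = 0.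
Proof. by move=> Uq; rewrite /fund_inv invmx_fund_mx_twisted// block_mxEur mxE. Qed.

Lemma fund_inv_twisted_rl b i q : U q ->
  fund_inv F (rshift n1 b) (lshift n2 i) q = 0.
Proof. by move=> Uq; rewrite /fund_inv invmx_fund_mx_twisted// block_mxEdl mxE. Qed.

Lemma fund_inv_twisted_rr a b q : U q ->
  fund_inv F (rshift n1 a) (rshift n1 b) q = (f2 (prz q))^-1 * fund_inv F2 a b (pr2 q).
Proof. by move=> Uq; rewrite /fund_inv invmx_fund_mx_twisted// block_mxEdr mxE. Qed.

Lemma coord_l q k : q.2 ord0 (lshift n2 k) = (pr1 q).2 ord0 k.
Proof. by rewrite mxE. Qed.

Lemma coord_r q k : q.2 ord0 (rshift n1 k) = (pr2 q).2 ord0 k.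
Proof. by rewrite mxE. Qed.

(** * Spray coefficients of the twisted product *)

Lemma pd1_sqF_twisted_l l q : U q -> pd1 (lshift n2 l) (sqF F) q =
  pd1 l L1 (pr1 q) + 2 * (f (prz q) * pd1 l f (prz q)) * L2 (pr2 q).
Proof.
move=> Uq; rewrite sqF_twisted.
rewrite (pd1D _ (smooth_sep oD1 oD2 (s1 _) sL1 (s1 _)) (smooth_sep oD1 oD2 sf2 (s1 _) sL2) Uq).
rewrite (pd1_sep_l oD1 oD2 (s1 _) sL1 (s1 _) _ Uq) (pd1_sep_l oD1 oD2 sf2 (s1 _) sL2 _ Uq).
rewrite /sep !pd1_cst (pd1_f2 _ (slit_prod_prz Uq)).
by rewrite !mul0r !mul1r mulr0 !mulr1 add0r addr0.
Qed.

Lemma pd1_sqF_twisted_r b q : U q -> pd1 (rshift n1 b) (sqF F) q =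
  2 * (f (prz q) * pd2 b f (prz q)) * L2 (pr2 q) + f2 (prz q) * pd1 b L2 (pr2 q).
Proof.
move=> Uq; rewrite sqF_twisted.
rewrite (pd1D _ (smooth_sep oD1 oD2 (s1 _) sL1 (s1 _)) (smooth_sep oD1 oD2 sf2 (s1 _) sL2) Uq).
rewrite (pd1_sep_r oD1 oD2 (s1 _) sL1 (s1 _) _ Uq) (pd1_sep_r oD1 oD2 sf2 (s1 _) sL2 _ Uq).
rewrite /sep pd1_cst pd2_cst (pd2_f2 _ (slit_prod_prz Uq)).
by rewrite !mul0r !mul1r mulr0 !add0r.
Qed.

Lemma pd1_pd2_sqF_twisted_ll k l q : U q ->
  pd1 (lshift n2 k) (pd2 (lshift n2 l) (sqF F)) q = pd1 k (pd2 l L1) (pr1 q).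
Proof.
move=> Uq; rewrite (pd1_eq_on oU _ (pd2_sqF_twisted_l l) Uq).
rewrite (pd1_sep_l oD1 oD2 (s1 _) (smooth_pd2 _ sL1) (s1 _) _ Uq) /sep pd1_cst.
by rewrite mul0r !mul1r mulr1 add0r.
Qed.

Lemma pd1_pd2_sqF_twisted_rl g l q : U q ->
  pd1 (rshift n1 g) (pd2 (lshift n2 l) (sqF F)) q = 0.
Proof.
move=> Uq; rewrite (pd1_eq_on oU _ (pd2_sqF_twisted_l l) Uq).
rewrite (pd1_sep_r oD1 oD2 (s1 _) (smooth_pd2 _ sL1) (s1 _) _ Uq) /sep pd1_cst pd2_cst.
by rewrite mul0r !mulr0 add0r.
Qed.

Lemma pd1_pd2_sqF_twisted_lr k b q : U q ->
  pd1 (lshift n2 k) (pd2 (rshift n1 b) (sqF F)) q =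
  2 * (f (prz q) * pd1 k f (prz q)) * pd2 b L2 (pr2 q).
Proof.
move=> Uq; rewrite (pd1_eq_on oU _ (pd2_sqF_twisted_r b) Uq).
rewrite (pd1_sep_l oD1 oD2 sf2 (s1 _) (smooth_pd2 _ sL2) _ Uq) /sep pd1_cst.
by rewrite (pd1_f2 _ (slit_prod_prz Uq)) mul0r mulr0 addr0 mul1r.
Qed.

Lemma pd1_pd2_sqF_twisted_rr g b q : U q ->
  pd1 (rshift n1 g) (pd2 (rshift n1 b) (sqF F)) q =
  2 * (f (prz q) * pd2 g f (prz q)) * pd2 b L2 (pr2 q)
  + f2 (prz q) * pd1 g (pd2 b L2) (pr2 q).
Proof.
move=> Uq; rewrite (pd1_eq_on oU _ (pd2_sqF_twisted_r b) Uq).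
rewrite (pd1_sep_r oD1 oD2 sf2 (s1 _) (smooth_pd2 _ sL2) _ Uq) /sep.
by rewrite (pd2_f2 _ (slit_prod_prz Uq)) !mul1r.
Qed.

(** Since f^2 multiplies L2 only, F^2_(;l) does not see f or u; the twist enters solely through -
    dF^2/dx^l, which yields -1/4 * 2 f f_l L2. *)
Lemma spray_twisted_l i q : U q -> spray F (lshift n2 i) q =
  sep (fun=> 1) (spray F1 i) (fun=> 1) q
  + \sum_l sep (fun z => - 2^-1 * (f z * pd1 l f z)) (fund_inv F1 i l) L2 q.
Proof.
move=> Uq; rewrite /spray big_split_ord /= [X in _ + X]big1 ?addr0; last first.
  by move=> b _; rewrite (fund_inv_twisted_lr _ _ Uq) mul0r.
rewrite {1}/sep mul1r mulr1 !mulr_sumr -big_split /=; apply: eq_bigr => l _.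
rewrite (fund_inv_twisted_ll _ _ Uq) big_split_ord /= [X in _ + X - _]big1; last first.
  by move=> g _; rewrite (pd1_pd2_sqF_twisted_rl _ _ Uq) mul0r.
rewrite addr0 (pd1_sqF_twisted_l _ Uq).
rewrite (eq_bigr (fun k => pd1 k (pd2 l L1) (pr1 q) * (pr1 q).2 ord0 k)); last first.
  by move=> k _; rewrite (pd1_pd2_sqF_twisted_ll _ _ Uq) coord_l.
rewrite /sep; set S := \sum_(k < n1) _; move: S => S.
by atoms; move: (L2 _) (f _) => *; field.
Qed.

(** The two terms carrying f_b are kept in one summand, since [div_radial_minus_raised] computes
    their divergence together. *)
Lemma spray_twisted_r a q : U q -> spray F (rshift n1 a) q =
  sep (fun=> 1) (fun=> 1) (spray F2 a) q
  + \sum_k sep (fun z => (f z)^-1 * pd1 k f z) (fun r => r.2 ord0 k)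
             (fun r => r.2 ord0 a) q
  + \sum_b sep (fun z => (f z)^-1 * pd2 b f z) (fun=> 1)
      (fun r => r.2 ord0 b * r.2 ord0 a + - 2^-1 * (fund_inv F2 a b r * L2 r)) q.
Proof.
move=> Uq; have fq0 := f_neq0 Uq.
rewrite /spray big_split_ord /= [X in _ * (X + _)]big1 ?add0r; last first.
  by move=> b _; rewrite (fund_inv_twisted_rl _ _ Uq) mul0r.
set z := prz q; set r := pr2 q.
(* S is the derivative of f along (y, v), arising when f^2 L2_(;b) is differentiated along the
   base. *)
pose S := \sum_k pd1 k f z * (pr1 q).2 ord0 k + \sum_b pd2 b f z * r.2 ord0 b.
(* The 4 comes from (f^2)' = 2 f S and L2_(;b) = 2 v_b, the -2 from - d(f^2)/du^b; one factor f
   remains after division by f^2. *)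
rewrite (eq_bigr (fun b =>
    fund_inv F2 a b r * (\sum_k pd1 k (pd2 b L2) r * r.2 ord0 k - pd1 b L2 r)
    + 4 * ((f z)^-1 * S) * (fund_inv F2 a b r * low_y F2 b r)
    + - 2 * ((f z)^-1 * pd2 b f z) * (fund_inv F2 a b r * L2 r))); last first.
  move=> b _; rewrite (fund_inv_twisted_rr _ _ Uq) big_split_ord /=.
  rewrite (pd1_sqF_twisted_r _ Uq).
  rewrite (eq_bigr (fun k => 2 * f z * pd2 b L2 r * (pd1 k f z * (pr1 q).2 ord0 k)));
      last first.
    move=> k _; rewrite (pd1_pd2_sqF_twisted_lr _ _ Uq) coord_l -/z -/r.
    by atoms; move: (f z) ((pr1 q).2 ord0 k) => *; ring.
  rewrite [in X in _ + X - _](eq_bigr (fun k => 2 * f z * pd2 b L2 r * (pd2 k f z * r.2 ord0 k)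
      + f2 z * (pd1 k (pd2 b L2) r * r.2 ord0 k))); last first.
    move=> k _; rewrite (pd1_pd2_sqF_twisted_rr _ _ Uq) coord_r -/z -/r.
    by atoms; move: (f z) (f2 z) (r.2 ord0 k) => *; ring.
  rewrite big_split /= -!mulr_sumr.
  rewrite (pd2_sqF oD2 sF2 hF2 b (Uq.2 : A2 r)) /S /f2 -/z -/r.
  move: (\sum_(i < n1) _) (\sum_(i < n2) _) (\sum_(i < n2) _) => X Y Z.
  by atoms; move: fq0; rewrite -/z; move: (L2 r) (f z) => ? ? fq0; field.
rewrite !big_split /= -!mulr_sumr (raise_low_y pF2 a (Uq.2 : A2 r)).
have E2 : \sum_k sep (fun z => (f z)^-1 * pd1 k f z) (fun r => r.2 ord0 k)
      (fun r => r.2 ord0 a) q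
    = (f z)^-1 * (\sum_k pd1 k f z * (pr1 q).2 ord0 k) * r.2 ord0 a.
  rewrite mulr_sumr mulr_suml; apply: eq_bigr => k _.
  by rewrite /sep -/z -/r !mulrA.
have E3 : \sum_b sep (fun z => (f z)^-1 * pd2 b f z) (fun=> 1)
      (fun r => r.2 ord0 b * r.2 ord0 a + - 2^-1 * (fund_inv F2 a b r * L2 r)) q
    = (f z)^-1 * (\sum_b pd2 b f z * r.2 ord0 b) * r.2 ord0 a
      + 4^-1 * \sum_b - 2 * ((f z)^-1 * pd2 b f z) * (fund_inv F2 a b r * L2 r).
  rewrite !mulr_sumr mulr_suml -big_split /=; apply: eq_bigr => b _.
  rewrite /sep -/z -/r; atoms.
  by move: fq0; rewrite -/z; move: (L2 r) (f z) (r.2 ord0 _) (r.2 ord0 _) => ? ? ? ? fq0; field.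
rewrite E2 E3 /sep !mul1r -/r /spray /S.
move: (\sum_(b < n2) _) (\sum_(b < n2) _) (\sum_(b < n2) _) (\sum_(b < n1) _) => X1 X2 X3 X4.
by move: fq0; rewrite -/z; move: (r.2 ord0 _) (f z) => ? ? fq0; field.
Qed.

Let sI1 h : smooth_on A1 (mean_cartan F1 h) := smooth_mean_cartan oD1 sF1 pF1 h.
Let sI2 h : smooth_on A2 (mean_cartan F2 h) := smooth_mean_cartan oD2 sF2 pF2 h.
Let sG1 i : smooth_on A1 (spray F1 i) := smooth_spray oD1 sF1 pF1 i.
Let sG2 i : smooth_on A2 (spray F2 i) := smooth_spray oD2 sF2 pF2 i.
Let sg1 i j : smooth_on A1 (fund_inv F1 i j) := smooth_fund_inv oD1 sF1 pF1 i j.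
Let sg2 i j : smooth_on A2 (fund_inv F2 i j) := smooth_fund_inv oD2 sF2 pF2 i j.

(** * Fibre divergence of the spray as a sum of separated products *)

Section SepSum.
Variables (I : Type) (r : seq I) (c : I -> TRz -> R) (H : I -> TR1 -> R) (K : I -> TR2 -> R).
Hypotheses (sc : forall i, smooth_on Az (c i)) (sH : forall i, smooth_on A1 (H i)).
Hypothesis (sK : forall i, smooth_on A2 (K i)).
Let ss i := smooth_sep oD1 oD2 (sc i) (sH i) (sK i).

Lemma smooth_sep_sum : smooth_on U (fun q => \sum_(i <- r) sep (c i) (H i) (K i) q).
Proof. exact: (smooth_on_sum oU). Qed.

Lemma pd2_sep_sum_l j q : U q ->
  pd2 (lshift n2 j) (fun q => \sum_(i <- r) sep (c i) (H i) (K i) q) q =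
  \sum_(i <- r) sep (c i) (pd2 j (H i)) (K i) q.
Proof.
move=> Uq; rewrite (pd2_sum oU _ _ ss Uq); apply: eq_bigr => i _.
exact: (pd2_sep_l oD1 oD2 (sc i) (sH i) (sK i) _ Uq).
Qed.

Lemma pd2_sep_sum_r b q : U q ->
  pd2 (rshift n1 b) (fun q => \sum_(i <- r) sep (c i) (H i) (K i) q) q =
  \sum_(i <- r) sep (c i) (H i) (pd2 b (K i)) q.
Proof.
move=> Uq; rewrite (pd2_sum oU _ _ ss Uq); apply: eq_bigr => i _.
exact: (pd2_sep_r oD1 oD2 (sc i) (sH i) (sK i) _ Uq).
Qed.

End SepSum.

Let sc1 l : smooth_on Az (fun z => - 2^-1 * (f z * pd1 l f z)).
Proof. by smooth. Qed.
Let sc2 k : smooth_on Az (fun z => (f z)^-1 * pd1 k f z).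
Proof. by smooth. Qed.
Let sc3 b : smooth_on Az (fun z => (f z)^-1 * pd2 b f z).
Proof. by smooth. Qed.
Let sy1 k : smooth_on A1 (fun r => r.2 ord0 k).
Proof. exact: smooth_on_fibre_coord. Qed.
Let sy2 k : smooth_on A2 (fun r => r.2 ord0 k).
Proof. exact: smooth_on_fibre_coord. Qed.
Let sK2 a b : smooth_on A2
  (fun r => r.2 ord0 b * r.2 ord0 a + - 2^-1 * (fund_inv F2 a b r * L2 r)).
Proof. by smooth. Qed.

Let sl1 i := smooth_sep oD1 oD2 (s1 Az) (sG1 i) (s1 A2).
Let sl2 i := smooth_sep_sum (index_enum _) sc1 (sg1 i) (fun=> sL2).
Let sr1 a := smooth_sep oD1 oD2 (s1 Az) (s1 A1) (sG2 a).
Let sr2 a := smooth_sep_sum (index_enum _) sc2 sy1 (fun=> sy2 a).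
Let sr3 a := smooth_sep_sum (index_enum _) sc3 (fun=> s1 A1) (sK2 a).
Let sr12 a := smooth_onD oU (sr1 a) (sr2 a).

Lemma smooth_spray_twisted m : smooth_on U (spray F m).
Proof.
case: (split_ordP m) => [i ->|a ->].
  apply: (smooth_on_eq oU _ (smooth_onD oU (sl1 i) (sl2 i))) => q.
  by rewrite inE => Uq; rewrite (spray_twisted_l _ Uq).
apply: (smooth_on_eq oU _ (smooth_onD oU (sr12 a) (sr3 a))) => q.
by rewrite inE => Uq; rewrite (spray_twisted_r _ Uq).
Qed.

Lemma pd2_spray_twisted_l i q : U q -> pd2 (lshift n2 i) (spray F (lshift n2 i)) q =
  pd2 i (spray F1 i) (pr1 q)
  + \sum_l - 2^-1 * (f (prz q) * pd1 l f (prz q)) *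
      (pd2 i (fund_inv F1 i l) (pr1 q) * L2 (pr2 q)).
Proof.
move=> Uq; rewrite (pd2_eq_on oU _ (spray_twisted_l i) Uq) (pd2D _ (sl1 i) (sl2 i) Uq).
rewrite (pd2_sep_l oD1 oD2 (s1 Az) (sG1 i) (s1 A2) _ Uq).
rewrite (pd2_sep_sum_l _ sc1 (sg1 i) (fun=> sL2) _ Uq).
by rewrite {1}/sep mul1r mulr1.
Qed.

Lemma pd2_spray_twisted_r a q : U q -> pd2 (rshift n1 a) (spray F (rshift n1 a)) q =
  pd2 a (spray F2 a) (pr2 q)
  + \sum_k (f (prz q))^-1 * pd1 k f (prz q) * (pr1 q).2 ord0 k
  + \sum_b (f (prz q))^-1 * pd2 b f (prz q) *
      pd2 a (fun r => r.2 ord0 b * r.2 ord0 a + - 2^-1 * (fund_inv F2 a b r * L2 r)) (pr2 q).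
Proof.
move=> Uq; rewrite (pd2_eq_on oU _ (spray_twisted_r a) Uq).
rewrite (pd2D _ (sr12 a) (sr3 a) Uq) (pd2D _ (sr1 a) (sr2 a) Uq).
rewrite (pd2_sep_r oD1 oD2 (s1 Az) (s1 A1) (sG2 a) _ Uq).
rewrite (pd2_sep_sum_r _ sc2 sy1 (fun=> sy2 a) _ Uq).
rewrite (pd2_sep_sum_r _ sc3 (fun=> s1 A1) (sK2 a) _ Uq).
rewrite {1}/sep !mul1r; congr (_ + _ + _).
  by apply: eq_bigr => k _; rewrite /sep pd2_fibre_coord eqxx mulr1.
by apply: eq_bigr => b _; rewrite /sep mul1r.
Qed.

(* Indexes the summands of the fibre divergence: div G1, div G2, and the families
   f f_h I^h L2, f^-1 f_k y^k n2 and f^-1 f_b (n2 v^b + I^b L2). *)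
Let Idiv := ((unit + unit) + ('I_n1 + ('I_n1 + 'I_n2)))%type.
Lemma sum_Idiv (G : Idiv -> R) : \sum_s G s =
  G (inl (inl tt)) + G (inl (inr tt)) +
  (\sum_h G (inr (inl h)) +
   (\sum_k G (inr (inr (inl k))) + \sum_b G (inr (inr (inr b))))).
Proof.
have sum_unit (H : unit -> R) : \sum_i H i = H tt by rewrite (big_pred1 tt)// => -[].
by rewrite !big_sumType /= !sum_unit.
Qed.

(** With a single index type, all five families are differentiated at once by [pd2_sep_sum_l] and
    [pd2_sep_sum_r]. *)
Let cdiv (s : Idiv) : TRz -> R :=
  match s with
  | inl _ => fun=> 1
  | inr (inl h) => fun z => f z * pd1 h f z
  | inr (inr (inl k)) => fun z => (f z)^-1 * pd1 k f z
  | inr (inr (inr b)) => fun z => (f z)^-1 * pd2 b f z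
  end.
Let Hdiv (s : Idiv) : TR1 -> R :=
  match s with
  | inl (inl _) => fun r => \sum_i pd2 i (spray F1 i) r
  | inr (inl h) => mean_cartan F1 h
  | inr (inr (inl k)) => fun r => r.2 ord0 k
  | _ => fun=> 1
  end.
Let Kdiv (s : Idiv) : TR2 -> R :=
  match s with
  | inl (inl _) => fun=> 1
  | inl (inr _) => fun r => \sum_a pd2 a (spray F2 a) r
  | inr (inl _) => L2
  | inr (inr (inl _)) => fun=> n2%:R
  | inr (inr (inr b)) => fun r => n2%:R * r.2 ord0 b + mean_cartan F2 b r * L2 r
  end.

Let scdiv s : smooth_on Az (cdiv s).
Proof. by case: s => [?|[?|[?|?]]] /=; smooth. Qed.
Let sHdiv s : smooth_on A1 (Hdiv s).
Proof. by case: s => [[?|?]|[?|[?|?]]] /=; smooth. Qed.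
Let sKdiv s : smooth_on A2 (Kdiv s).
Proof. by case: s => [[?|?]|[?|[?|?]]] /=; smooth. Qed.

Lemma div_spray_twisted q : U q -> \sum_m pd2 m (spray F m) q =
  \sum_s sep (cdiv s) (Hdiv s) (Kdiv s) q.
Proof.
move=> Uq; rewrite big_split_ord sum_Idiv /=.
rewrite (eq_bigr _ (fun i _ => pd2_spray_twisted_l i Uq)).
rewrite (eq_bigr _ (fun a _ => pd2_spray_twisted_r a Uq)).
rewrite !big_split /= /sep !mul1r mulr1.
rewrite [X in _ + X + _]exchange_big [X in _ + (_ + _ + X)]exchange_big /=.
set z := prz q; set r1 := pr1 q; set r2 := pr2 q.
(* The factor -1/2 cancels the -2 of [div_fund_inv]. *)
have E1 : \sum_(l < n1) \sum_(i < n1) - 2^-1 * (f z * pd1 l f z) *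
      (pd2 i (fund_inv F1 i l) r1 * L2 r2) =
    \sum_(l < n1) f z * pd1 l f z * (mean_cartan F1 l r1 * L2 r2).
  apply: eq_bigr => l _; rewrite -mulr_sumr -mulr_suml.
  rewrite (div_fund_inv oD1 sF1 pF1 l (Uq.1 : A1 r1)).
  by atoms; move: (f z) (L2 r2) => *; field.
(* The trace of dv^a/dv^a over M_2 produces the dimension n2. *)
have E2 : \sum_(a < n2) \sum_k (f z)^-1 * pd1 k f z * r1.2 ord0 k =
    \sum_k (f z)^-1 * pd1 k f z * (r1.2 ord0 k * n2%:R).
  rewrite sumr_const card_ord -[LHS]mulr_natr mulr_suml.
  by apply: eq_bigr => k _; rewrite mulrA.
have E3 : \sum_b \sum_(a < n2) (f z)^-1 * pd2 b f z *
      pd2 a (fun r => r.2 ord0 b * r.2 ord0 a + - 2^-1 * (fund_inv F2 a b r * L2 r)) r2 =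
    \sum_b (f z)^-1 * pd2 b f z *
      (1 * (n2%:R * r2.2 ord0 b + mean_cartan F2 b r2 * L2 r2)).
  apply: eq_bigr => b _; rewrite -mulr_sumr mul1r.
  by rewrite (div_radial_minus_raised oD2 sF2 hF2 pF2 b (Uq.2 : A2 r2)).
rewrite E1 E2 E3.
move: (\sum_(i < n1) _) (\sum_(i < n1) _) (\sum_(i < n2) _) (\sum_(i < n1) _) (\sum_(i < n2) _) => *.
ring.
Qed.

Let Ddiv q := \sum_s sep (cdiv s) (Hdiv s) (Kdiv s) q.

(** * The three blocks of the mean Berwald curvature *)

Lemma mean_berwald_twisted A B q : U q ->
  mean_berwald F A B q = 2^-1 * pd2 A (pd2 B Ddiv) q.
Proof.
move=> Uq; rewrite (mean_berwald_div _ _ oU smooth_spray_twisted Uq).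
have E r : U r -> pd2 B (fun q => \sum_m pd2 m (spray F m) q) r = pd2 B Ddiv r.
  exact: (pd2_eq_on oU _ div_spray_twisted).
by rewrite (pd2_eq_on oU A E Uq).
Qed.

(** Only div G1 and the I^h family can have a nonzero Hessian in y; the other families are constant
    or linear in y. *)
Lemma mean_berwald_twisted_ll i j q : U q ->
  mean_berwald F (lshift n2 i) (lshift n2 j) q =
  mean_berwald F1 i j (pr1 q)
  + 2^-1 * f (prz q)
    * (\sum_h pd2 i (pd2 j (mean_cartan F1 h)) (pr1 q) * pd1 h f (prz q)) * L2 (pr2 q).
Proof.
move=> Uq; rewrite (mean_berwald_twisted _ _ Uq).
rewrite (pd2_eq_on oU _ (fun r => pd2_sep_sum_l _ scdiv sHdiv sKdiv j (q := r)) Uq).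
rewrite (pd2_sep_sum_l _ scdiv (fun s => smooth_pd2 j (sHdiv s)) sKdiv i Uq).
have -> : \sum_s sep (cdiv s) (pd2 i (pd2 j (Hdiv s))) (Kdiv s) q =
    pd2 i (pd2 j (fun r => \sum_m pd2 m (spray F1 m) r)) (pr1 q)
    + f (prz q) * (\sum_h pd2 i (pd2 j (mean_cartan F1 h)) (pr1 q) * pd1 h f (prz q))
      * L2 (pr2 q).
  rewrite sum_Idiv /= {1 2}/sep hess_cst.
  have E (X Y : R) : 1 * (X * 1) + 1 * (0 * Y) = X by ring.
  rewrite E [X in _ + (_ + (X + _))]big1; last first.
    by move=> k _; rewrite /sep hess_fibre_coord mul0r mulr0.
  rewrite [X in _ + (_ + (_ + X))]big1; last first.
    by move=> k _; rewrite /sep hess_cst mul0r mulr0.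
  rewrite !addr0 mulr_sumr mulr_suml; congr (_ + _); apply: eq_bigr => h _.
  by rewrite /sep; atoms; move: (f _) (L2 _) => *; ring.
rewrite mulrDr (mean_berwald_div _ _ oA1 sG1 Uq.1); congr (_ + _).
by rewrite !mulrA.
Qed.

(** A mixed derivative kills every summand that is constant in y or in v, leaving the I^h L2 family;
    the 1/2 in E cancels the 2 of L2_(;beta) = 2 v_beta. *)
Lemma mean_berwald_twisted_lr i b q : U q ->
  mean_berwald F (lshift n2 i) (rshift n1 b) q =
  f (prz q) * (\sum_h pd2 i (mean_cartan F1 h) (pr1 q) * pd1 h f (prz q))
    * low_y F2 b (pr2 q).
Proof.
move=> Uq; rewrite (mean_berwald_twisted _ _ Uq).
rewrite (pd2_eq_on oU _ (fun r => pd2_sep_sum_r _ scdiv sHdiv sKdiv b (q := r)) Uq).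
rewrite (pd2_sep_sum_l _ scdiv sHdiv (fun s => smooth_pd2 b (sKdiv s)) i Uq).
rewrite sum_Idiv /= {1 2}/sep !pd2_cst.
rewrite mul0r !mulr0 !add0r [X in _ * (_ + (X + _))]big1; last first.
  by move=> k _; rewrite /sep pd2_cst !mulr0.
rewrite [X in _ * (_ + (_ + X))]big1; last first.
  by move=> k _; rewrite /sep pd2_cst mul0r mulr0.
rewrite !addr0 mulr_sumr [f (prz q) * (\sum_(h < n1) _)]mulr_sumr mulr_suml.
apply: eq_bigr => h _; rewrite /sep (pd2_sqF oD2 sF2 hF2 b Uq.2).
by atoms; move: (f _) => *; field.
Qed.

(** Here div G1 and the f_k y^k family drop out, being constant in v. Half the Hessian of L2 is
    g_(alpha beta), and the last family is handled by [hess_mean_cartan_sqF]. *)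
Lemma mean_berwald_twisted_rr al be q : U q ->
  mean_berwald F (rshift n1 al) (rshift n1 be) q =
  mean_berwald F2 al be (pr2 q)
  + f (prz q) * fund F2 al be (pr2 q)
    * (\sum_h mean_cartan F1 h (pr1 q) * pd1 h f (prz q))
  + 2^-1 * (f (prz q))^-1
    * (\sum_nu pd2 be (pd2 al (mean_cartan F2 nu)) (pr2 q) * pd2 nu f (prz q))
    * L2 (pr2 q)
  + (f (prz q))^-1 * (\sum_nu pd2 nu f (prz q) *
      (pd2 al (mean_cartan F2 nu) (pr2 q) * low_y F2 be (pr2 q)
       + pd2 be (mean_cartan F2 nu) (pr2 q) * low_y F2 al (pr2 q)
       + mean_cartan F2 nu (pr2 q) * fund F2 al be (pr2 q))).
Proof.
move=> Uq; rewrite (mean_berwald_twisted _ _ Uq).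
rewrite (pd2_eq_on oU _ (fun r => pd2_sep_sum_r _ scdiv sHdiv sKdiv be (q := r)) Uq).
rewrite (pd2_sep_sum_r _ scdiv sHdiv (fun s => smooth_pd2 be (sKdiv s)) al Uq).
rewrite sum_Idiv /= {1 2}/sep.
rewrite -> (hess_cst 1 al be (pr2 q)).
have E (X Y : R) : 1 * (X * 0) + 1 * (1 * Y) = Y by ring.
rewrite E [X in _ * (_ + (_ + (X + _)))]big1; last first.
  by move=> k _; rewrite /sep hess_cst !mulr0.
rewrite add0r !mulrDr (mean_berwald_div _ _ oA2 sG2 Uq.2) -!addrA; congr (_ + _).
congr (_ + _).
  rewrite !mulr_sumr; apply: eq_bigr => h _.
  rewrite /sep (fundC oD2 sF2 al be Uq.2) /fund.
  by atoms; move: (f _) => *; field.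
rewrite !mulr_sumr mulr_suml -big_split /=; apply: eq_bigr => nu _.
rewrite /sep (hess_mean_cartan_sqF oD2 sF2 hF2 pF2 n2%:R nu al be Uq.2).
have := f_neq0 Uq.
by atoms; move: (f _) (L2 _) => ? ? f_neq0; field.
Qed.

End Twisted.

Theorem lemma7 (R : realType) (n1 n2 : nat)
    (M1 : finsler_manifold R n1) (M2 : finsler_manifold R n2)
    (f : M1 * M2 -> R)
    (f_gt0 : forall p, 0 < f p) (f_smooth : smooth_prod f)
    (a : atlas M1) (b : atlas M2)
    (x y : 'rV[R]_n1) (u v : 'rV[R]_n2)
    (x_in : cdom a x) (u_in : cdom b u) (y_neq0 : y != 0) (v_neq0 : v != 0) :
  let F1 := metric a in
  let F2 := metric b in
  let F := twisted_product f a b in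
  let fl := local_expr f a b in
  let p := (x, y) in
  let q := (u, v) in
  let z := (x, u) in
  let P := (row_mx x u, row_mx y v) in
  [/\ forall al be : 'I_n2,
        mean_berwald F (rshift n1 al) (rshift n1 be) P =
          mean_berwald F2 al be q
          + fl z * fund F2 al be q * (\sum_h mean_cartan F1 h p * pd1 h fl z)
          + 2^-1 * (fl z)^-1
              * (\sum_nu pd2 be (pd2 al (mean_cartan F2 nu)) q * pd2 nu fl z)
              * F2 q ^+ 2
          + (fl z)^-1 * (\sum_nu pd2 nu fl z *
              ((\sum_ga pd2 be (cartan_uu F2 ga nu al) q * low_y F2 ga q)
               + pd2 al (mean_cartan F2 nu) q * low_y F2 be q
               + pd2 be (mean_cartan F2 nu) q * low_y F2 al q
               + cartan_u F2 nu al be q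
               + mean_cartan F2 nu q * fund F2 al be q)),
      forall i j : 'I_n1,
        mean_berwald F (lshift n2 i) (lshift n2 j) P =
          mean_berwald F1 i j p
          + 2^-1 * fl z
              * (\sum_h pd2 i (pd2 j (mean_cartan F1 h)) p * pd1 h fl z)
              * F2 q ^+ 2
    & forall (i : 'I_n1) (be : 'I_n2),
        mean_berwald F (lshift n2 i) (rshift n1 be) P =
          fl z * (\sum_h pd2 i (mean_cartan F1 h) p * pd1 h fl z)
            * low_y F2 be q].
Proof.
move=> F1 F2 F fl p q z P.
have P1 : pr1 P = p by rewrite /pr1 /= !row_mxKl.
have P2 : pr2 P = q by rewrite /pr2 /= !row_mxKr.
have Pz : prz P = z by rewrite /prz /= row_mxKl row_mxKr.
have UP : slit_prod (cdom a) (cdom b) P.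
  by split; rewrite /preimage /mkset ?P1 ?P2; split.
have o1 : open (cdom a) by exact: cdom_open.
have o2 : open (cdom b) by exact: cdom_open.
have s1 := @metric_smooth _ _ M1 a; have s2 := @metric_smooth _ _ M2 b.
have h2 := @metric_homogeneous _ _ M2 b.
have p1 := @metric_posdef _ _ M1 a; have p2 := @metric_posdef _ _ M2 b.
(* Positivity of f holds at every point of the product, so it transfers to the chart expression. *)
have fl0 : forall z, (cdom a `*` cdom b) z -> fl z != 0.
  by move=> z' _; rewrite gt_eqF// /fl /local_expr.
split=> [al be|i j|i be].
- rewrite (mean_berwald_twisted_rr o1 o2 s1 p1 s2 h2 p2 (f_smooth a b) fl0 al be UP).
  rewrite P1 P2 Pz; congr (_ + _ * _); apply: eq_bigr => nu _; congr (_ * _).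
  rewrite (pd2_cartan_uu_low_y o2 s2 h2 p2 nu al be (conj u_in v_neq0 : _ q)).
  by rewrite /F2; atoms; move: (cartan_u _ _ _ _ _) => *; ring.
- rewrite (mean_berwald_twisted_ll o1 o2 s1 p1 s2 h2 p2 (f_smooth a b) fl0 i j UP).
  by rewrite P1 P2 Pz.
- rewrite (mean_berwald_twisted_lr o1 o2 s1 p1 s2 h2 p2 (f_smooth a b) fl0 i be UP).
  by rewrite P1 P2 Pz.
Qed.
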